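(* Let $\mathcal{H}$ be a separable right quaternionic Hilbert space with orthonormal bases indexed by $\mathbb{N}$, and let $T\in\mathcal{B}(\mathcal{H})$ be a complex operator. Then $$\overline{B^+(T)}=\mathrm{conv}\,\{\overline{W^+_{\mathbb{C}}(T)},\ \overline{W^+_{\mathbb{C}}(T^* )},\ \underline{v},\ \overline{v}\},$$ where $\underline{v}=\inf\,(B(T)\cap\mathbb{R})$, $\overline{v}=\sup\,(B(T)\cap\mathbb{R})$, and $\mathrm{conv}$ of the listed sets and points denotes the convex hull of their union.
   Context: $\mathbb{H}$ denotes the real quaternions with basis $\{1,i,j,k\}$, $\mathbb{C}=\mathrm{span}_{\mathbb{R}}\{1,i\}\subset\mathbb{H}$, and $\mathbb{C}^+$ is the closed upper half-plane of $\mathbb{C}$. $\mathcal{H}$ is a right quaternionic Hilbert space with inner product $\langle\cdot,\cdot\rangle$ that is right $\mathbb{H}$-linear in the first variable, satisfies $\langle x,y\rangle=\langle y,x\rangle^*$ and is positive definite; $\mathcal{H}$ is separable, with countable orthonormal bases indexed by $\mathbb{N}$. $\mathcal{B}(\mathcal{H})$ is the set of bounded right $\mathbb{H}$-linear operators on $\mathcal{H}$. The quaternionic numerical range is $W(T)=\{\langle Tx,x\rangle:x\in\mathcal{H},\|x\|=1\}\subset\mathbb{H}$; the bild is $B(T)=W(T)\cap\mathbb{C}$ and the upper bild is $B^+(T)=W(T)\cap\mathbb{C}^+$. The set $B(T)\cap\mathbb{R}$ is a bounded interval. $T$ is a complex operator if there is an orthonormal basis $\mathcal{E}=\{e_n:n\in\mathbb{N}\}$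 of $\mathcal{H}$ with $\langle Te_n,e_m\rangle\in\mathbb{C}$ for all $n,m$. Fixing such $\mathcal{E}$, $\mathcal{H}_{\mathbb{C}}=\overline{\mathrm{span}_{\mathbb{C}}\,\mathcal{E}}$ is the right complex Hilbert space with orthonormal basis $\mathcal{E}$ (with restricted inner product, which is $\mathbb{C}$-valued on it); $T$ and $T^*$ map $\mathcal{H}_{\mathbb{C}}$ into itself. The complex numerical range is $W_{\mathbb{C}}(T)=\{\langle Tx,x\rangle:x\in\mathcal{H}_{\mathbb{C}},\|x\|=1\}$ (similarly for $T^*$), and $W_{\mathbb{C}}^+(T)=W_{\mathbb{C}}(T)\cap\mathbb{C}^+$, $W_{\mathbb{C}}^+(T^* )=W_{\mathbb{C}}(T^* )\cap\mathbb{C}^+$. *)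

(* Defs.v *)
From HB Require Import structures.
From mathcomp Require Import all_boot all_order all_algebra.
From mathcomp Require Import all_classical all_reals all_analysis.
From mathcomp Require Import ring.

Set Implicit Arguments.
Unset Strict Implicit.
Unset Printing Implicit Defensive.

Import Order.TTheory GRing.Theory Num.Theory.
Import numFieldNormedType.Exports.

Local Open Scope classical_set_scope.
Local Open Scope ring_scope.

(* The tuple (a, b, c, d) stands for a + b i + c j + d k. Only the real vector
   space structure and the topology are taken from R * R * R * R: the product
   is Hamilton's, and the max norm of the product type is left out. *)
Definition quat (R : realType) : Type := (R * R * R * R)%type.

Section Quaternions.
Context {R : realType}.
Implicit Types p q : quat R.

HB.instance Definition _ := Tvs.copy (quat R) (R * R * R * R)%type.

Definition qre q : R := q.1.1.1.
Definition qim_i q : R := q.1.1.2.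
Definition qim_j q : R := q.1.2.
Definition qim_k q : R := q.2.

Definition qreal (r : R) : quat R := (r, 0, 0, 0).

Definition qone : quat R := qreal 1.

Definition qmul p q : quat R :=
  let: (a, b, c, d) := p in
  let: (a', b', c', d') := q in
  (a * a' - b * b' - c * c' - d * d',
   a * b' + b * a' + c * d' - d * c',
   a * c' - b * d' + c * a' + d * b',
   a * d' + b * c' - c * b' + d * a').

Definition qconj q : quat R := (qre q, - qim_i q, - qim_j q, - qim_k q).

Fact qmulA : associative qmul.
Proof.
move=> [[[a b] c] d] [[[a' b'] c'] d'] [[[a'' b''] c''] d''] /=.
by congr (_, _, _, _); ring.
Qed.

Fact qmul1l : left_id qone qmul.
Proof. by move=> [[[a b] c] d] /=; congr (_, _, _, _); ring. Qed.

Fact qmul1r : right_id qone qmul.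
Proof. by move=> [[[a b] c] d] /=; congr (_, _, _, _); ring. Qed.

Fact qmulDl : left_distributive qmul +%R.
Proof.
move=> [[[a b] c] d] [[[a' b'] c'] d'] [[[a'' b''] c''] d''] /=.
by congr (_, _, _, _) => /=; ring.
Qed.

Fact qmulDr : right_distributive qmul +%R.
Proof.
move=> [[[a b] c] d] [[[a' b'] c'] d'] [[[a'' b''] c''] d''] /=.
by congr (_, _, _, _) => /=; ring.
Qed.

Fact qone_neq0 : qone != 0.
Proof. by apply/eqP => -[] /eqP; rewrite oner_eq0. Qed.

HB.instance Definition _ := GRing.Zmodule_isNzRing.Build (quat R)
  qmulA qmul1l qmul1r qmulDl qmulDr qone_neq0.

Definition qcomplex : set (quat R) := [set q | qim_j q = 0 /\ qim_k q = 0].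

Definition qupper : set (quat R) := qcomplex `&` [set q | 0 <= qim_i q].

Definition conv_hull (A : set (quat R)) : set (quat R) :=
  smallest (@convex_set R (quat R)) A.

End Quaternions.

(* Right H-modules are left modules over the converse ring, so that
   [x *> (p * q) = (x *> p) *> q]. *)
Notation quatc R := (GRing.converse (quat R)).
Notation "x *> q" := (@GRing.scale (quatc _) _ q x)
  (at level 40, left associativity) : ring_scope.

HB.mixin Record Lmodule_isQuatPreHilbert (R : realType) V
    of GRing.Lmodule (quatc R) V := {
  ip : V -> V -> quat R;
  ipDl : forall x y z, ip (x + y) z = ip x z + ip y z;
  ipZl : forall x (q : quat R) z, ip (x *> q) z = ip x z * q;
  ipC : forall x y, ip x y = qconj (ip y x);
  (* the other components of [ip x x] vanish by [ipC] *)
  ip_gt0 : forall x, x != 0 -> 0 < qre (ip x x)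
}.

#[short(type="quatPreHilbertType")]
HB.structure Definition QuatPreHilbert (R : realType) :=
  {V of GRing.Lmodule (quatc R) V & Lmodule_isQuatPreHilbert R V}.

Definition hnorm (R : realType) (V : quatPreHilbertType R) (x : V) : R :=
  Num.sqrt (qre (ip x x)).

HB.mixin Record QuatPreHilbert_isComplete (R : realType) V
    of QuatPreHilbert R V := {
  hnorm_complete : forall u : nat -> V,
    (forall eps : R, 0 < eps -> exists N, forall m n,
       (N <= m)%N -> (N <= n)%N -> hnorm (u m - u n) < eps) ->
    exists l : V, forall eps : R, 0 < eps -> exists N, forall n,
      (N <= n)%N -> hnorm (u n - l) < eps
}.

#[short(type="quatHilbertType")]
HB.structure Definition QuatHilbert (R : realType) :=
  {V of QuatPreHilbert R V & QuatPreHilbert_isComplete R V}.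

Section Operators.
Context {R : realType} {V : quatHilbertType R}.
Implicit Types (T : V -> V) (E : nat -> V) (D : set V).

(* norm closure of the finite right linear combinations of E with
   coefficients in K *)
Definition closed_span (K : set (quat R)) E : set V :=
  [set x | forall eps : R, 0 < eps ->
    exists (N : nat) (a : nat -> quat R),
      (forall n, K (a n)) /\ hnorm (x - \sum_(n < N) E n *> a n) < eps].

Definition orthonormal_basis E : Prop :=
  (forall n m, ip (E n) (E m) = (n == m)%:R) /\ closed_span setT E = setT.

Definition bounded_operator T : Prop :=
  exists M : R, forall x, hnorm (T x) <= M * hnorm x.

(* For a bounded right linear T the vector z exists and is unique
   (Riesz); 0 is a dummy value. *)
Definition adjoint T : V -> V :=
  fun y => xget 0 [set z | forall x, ip (T x) y = ip x z].

(* T is a complex operator when such an E exists. *)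
Definition complex_basis T E : Prop :=
  orthonormal_basis E /\ forall n m, qcomplex (ip (T (E n)) (E m)).

Definition complex_subspace E : set V := closed_span qcomplex E.

Definition range_on D T : set (quat R) :=
  [set ip (T x) x | x in D `&` [set x | hnorm x = 1]].

Definition num_range T : set (quat R) := range_on setT T.

Definition bild T : set (quat R) := num_range T `&` qcomplex.

Definition upper_bild T : set (quat R) := num_range T `&` qupper.

Definition real_bild T : set R := [set r | bild T (qreal r)].

Definition complex_num_range E T : set (quat R) :=
  range_on (complex_subspace E) T.

Definition upper_complex_num_range E T : set (quat R) :=
  complex_num_range E T `&` qupper.

End Operators.

(* Main.v *)
(** Conjugating by unit quaternions turns [upper_bild T] into the set of all
    pairs (Re <Tx,x>, |Im <Tx,x>|), x a unit vector. This set is convex for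
    every right linear [T]: two unit vectors span a space with an orthonormal
    basis diagonalising the skew-Hermitian part of [T], and there |Im <Tx,x>|
    is both a Euclidean norm and a "Lorentzian" one in the entries of the rank
    one matrix x x^H. To realise a convex combination, average the two rank one
    matrices; the two triangle inequalities leave room to move the off-diagonal
    entry, within its C and Cj parts and orthogonally to the Hermitian part of
    [T], until the average has rank one and the right |Im <Tx,x>|. With
    the endpoints of the real bild being limits of its points, the hull is
    contained in the closure.

    Conversely, write x = u + v j with u and v in the complex subspace. If
    <Tx,x> is complex then so is the whole segment from <Tu,u> / |u|^2 to
    <T* v,v> / |v|^2, with every point of it in the bild, and <Tx,x> lies on it.
    If that segment leaves the upper half-plane, it does so through a point
    of the real bild. Hence a dense part of [upper_bild T] lies in the union of
    the segments joining points of a compact set, which is closed. *)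

Require Import Defs.
From HB Require Import structures.
From mathcomp Require Import all_boot all_order all_algebra.
From mathcomp Require Import all_classical all_reals all_analysis.
From mathcomp Require Import ring lra.

Set Implicit Arguments.
Unset Strict Implicit.
Unset Printing Implicit Defensive.

Import Order.TTheory GRing.Theory Num.Theory.
Import numFieldNormedType.Exports.

Local Open Scope classical_set_scope.
Local Open Scope ring_scope.

(** * Components, norms and conjugation of quaternions *)

Section QuaternionAlgebra.
Context {R : realType}.
Implicit Types (p q : quat R) (r : R).

Lemma quatP p q : qre p = qre q -> qim_i p = qim_i q ->
  qim_j p = qim_j q -> qim_k p = qim_k q -> p = q.
Proof.
by move: p q => [[[a b] c] d] [[[a' b'] c'] d'] /=;
  rewrite /qre /qim_i /qim_j /qim_k /= => -> -> -> ->.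
Qed.

Lemma qreD p q : qre (p + q) = qre p + qre q. Proof. by []. Qed.
Lemma qim_iD p q : qim_i (p + q) = qim_i p + qim_i q. Proof. by []. Qed.
Lemma qim_jD p q : qim_j (p + q) = qim_j p + qim_j q. Proof. by []. Qed.
Lemma qim_kD p q : qim_k (p + q) = qim_k p + qim_k q. Proof. by []. Qed.
Lemma qreN p : qre (- p) = - qre p. Proof. by []. Qed.
Lemma qim_iN p : qim_i (- p) = - qim_i p. Proof. by []. Qed.
Lemma qim_jN p : qim_j (- p) = - qim_j p. Proof. by []. Qed.
Lemma qim_kN p : qim_k (- p) = - qim_k p. Proof. by []. Qed.
Lemma qreZ r p : qre (r *: p) = r * qre p. Proof. by []. Qed.
Lemma qim_iZ r p : qim_i (r *: p) = r * qim_i p. Proof. by []. Qed.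
Lemma qim_jZ r p : qim_j (r *: p) = r * qim_j p. Proof. by []. Qed.
Lemma qim_kZ r p : qim_k (r *: p) = r * qim_k p. Proof. by []. Qed.

Lemma qreM p q : qre (p * q) =
  qre p * qre q - qim_i p * qim_i q - qim_j p * qim_j q - qim_k p * qim_k q.
Proof. by move: p q => [[[a b] c] d] [[[a' b'] c'] d']. Qed.
Lemma qim_iM p q : qim_i (p * q) =
  qre p * qim_i q + qim_i p * qre q + qim_j p * qim_k q - qim_k p * qim_j q.
Proof. by move: p q => [[[a b] c] d] [[[a' b'] c'] d']. Qed.
Lemma qim_jM p q : qim_j (p * q) =
  qre p * qim_j q - qim_i p * qim_k q + qim_j p * qre q + qim_k p * qim_i q.
Proof. by move: p q => [[[a b] c] d] [[[a' b'] c'] d']. Qed.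
Lemma qim_kM p q : qim_k (p * q) =
  qre p * qim_k q + qim_i p * qim_j q - qim_j p * qim_i q + qim_k p * qre q.
Proof. by move: p q => [[[a b] c] d] [[[a' b'] c'] d']. Qed.

Lemma qcomp0 : (qre (0 : quat R) = 0) * (qim_i (0 : quat R) = 0) *
  (qim_j (0 : quat R) = 0) * (qim_k (0 : quat R) = 0).
Proof. by []. Qed.
Lemma qcomp1 : (qre (1 : quat R) = 1) * (qim_i (1 : quat R) = 0) *
  (qim_j (1 : quat R) = 0) * (qim_k (1 : quat R) = 0).
Proof. by []. Qed.
Lemma qcompE (a b c d : R) : (qre ((a, b, c, d) : quat R) = a) *
  (qim_i ((a, b, c, d) : quat R) = b) *
  (qim_j ((a, b, c, d) : quat R) = c) * (qim_k ((a, b, c, d) : quat R) = d).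
Proof. by []. Qed.
Lemma qcomp_real r : (qre (qreal r) = r) * (qim_i (qreal r) = 0) *
  (qim_j (qreal r) = 0) * (qim_k (qreal r) = 0).
Proof. by []. Qed.
Lemma qcomp_conj p : (qre (qconj p) = qre p) * (qim_i (qconj p) = - qim_i p) *
  (qim_j (qconj p) = - qim_j p) * (qim_k (qconj p) = - qim_k p).
Proof. by []. Qed.

(** Turns each component of a quaternion expression into a real polynomial, so that quaternion
    identities are left to [ring] one component at a time. *)
Definition quatE := (qreD, qim_iD, qim_jD, qim_kD, qreN, qim_iN, qim_jN, qim_kN,
  qreZ, qim_iZ, qim_jZ, qim_kZ, qreM, qim_iM, qim_jM, qim_kM,
  qcomp0, qcomp1, qcompE, qcomp_real, qcomp_conj).

Definition qnorm2 q : R := qre q ^+ 2 + qim_i q ^+ 2 + qim_j q ^+ 2 + qim_k q ^+ 2.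

Definition qim_norm2 q : R := qim_i q ^+ 2 + qim_j q ^+ 2 + qim_k q ^+ 2.

Lemma qnorm2_ge0 q : 0 <= qnorm2 q.
Proof. by rewrite /qnorm2 !addr_ge0// sqr_ge0. Qed.

Lemma qim_norm2_ge0 q : 0 <= qim_norm2 q.
Proof. by rewrite /qim_norm2 !addr_ge0// sqr_ge0. Qed.

Lemma qnorm2_eq0 q : qnorm2 q = 0 -> q = 0.
Proof.
rewrite /qnorm2 => h; have h1 := sqr_ge0 (qre q); have h2 := sqr_ge0 (qim_i q).
have h3 := sqr_ge0 (qim_j q); have h4 := sqr_ge0 (qim_k q).
by apply: quatP; apply/eqP; rewrite -sqrf_eq0; apply/eqP; lra.
Qed.

Lemma qnorm2_gt0 q : q != 0 -> 0 < qnorm2 q.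
Proof.
move=> q0; rewrite lt_neqAle qnorm2_ge0 andbT eq_sym.
by apply: contra_neq q0; exact: qnorm2_eq0.
Qed.

Lemma qnorm2M p q : qnorm2 (p * q) = qnorm2 p * qnorm2 q.
Proof. by rewrite /qnorm2 !quatE; ring. Qed.

Lemma qnorm2_conj q : qnorm2 (qconj q) = qnorm2 q.
Proof. by rewrite /qnorm2 !quatE; ring. Qed.

Lemma qnorm2_real r : qnorm2 (qreal r) = r ^+ 2.
Proof. by rewrite /qnorm2 !quatE; ring. Qed.

Lemma qconjK : involutive (@qconj R).
Proof. by move=> q; apply: quatP; rewrite !quatE ?opprK. Qed.

Lemma qconjD p q : qconj (p + q) = qconj p + qconj q.
Proof. by apply: quatP; rewrite !quatE ?opprD. Qed.

Lemma qconjN p : qconj (- p) = - qconj p.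
Proof. by apply: quatP; rewrite !quatE. Qed.

Lemma qconjM p q : qconj (p * q) = qconj q * qconj p.
Proof. by apply: quatP; rewrite !quatE; ring. Qed.

Lemma qconj0 : qconj (0 : quat R) = 0.
Proof. by apply: quatP; rewrite !quatE ?oppr0. Qed.

Lemma qmul_conjr q : q * qconj q = qreal (qnorm2 q).
Proof. by apply: quatP; rewrite /qnorm2 !quatE; ring. Qed.

Lemma qmul_conjl q : qconj q * q = qreal (qnorm2 q).
Proof. by apply: quatP; rewrite /qnorm2 !quatE; ring. Qed.

Lemma qreal_comm r q : qreal r * q = q * qreal r.
Proof. by apply: quatP; rewrite !quatE; ring. Qed.

Lemma qrealM r s : qreal (r * s) = qreal r * qreal s :> quat R.
Proof. by apply: quatP; rewrite !quatE; ring. Qed.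

Lemma qreal_scale r q : r *: q = q * qreal r.
Proof. by apply: quatP; rewrite !quatE; ring. Qed.

Lemma qconj_real r : qconj (qreal r) = qreal r.
Proof. by apply: quatP; rewrite !quatE ?oppr0. Qed.

Lemma qim_norm2_rotate p q : qnorm2 q = 1 ->
  qre (qconj q * p * q) = qre p /\ qim_norm2 (qconj q * p * q) = qim_norm2 p.
Proof.
move=> q1; have eqre : qre (qconj q * p * q) = qre p * qnorm2 q.
  by rewrite /qnorm2 !quatE; ring.
have eqim : qim_norm2 (qconj q * p * q) = qim_norm2 p * qnorm2 q ^+ 2.
  by rewrite /qim_norm2 /qnorm2 !quatE; ring.
by rewrite eqre eqim q1 expr1n !mulr1.
Qed.

(** The relation makes [w] the conjugate of [p] by [q]; dividing [q] by its norm turns its inverse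
    into [qconj]. *)
Lemma unit_conjugator p w q : q != 0 -> p * q = q * w ->
  exists2 u, qnorm2 u = 1 & qconj u * p * u = w.
Proof.
move=> q0 pq; have nq := qnorm2_gt0 q0.
have sq : Num.sqrt (qnorm2 q) != 0 by rewrite sqrtr_eq0 -ltNge.
pose s := (Num.sqrt (qnorm2 q))^-1.
have ss : qnorm2 q * (s * s) = 1.
  by rewrite -{1}(sqr_sqrtr (ltW nq)) /s; field.
exists (q * qreal s); first by rewrite qnorm2M qnorm2_real expr2.
rewrite qconjM qconj_real -!mulrA (mulrA p) pq -!mulrA -(qreal_comm s w).
rewrite (mulrA (qconj q)) qmul_conjl (mulrA (qreal s)) -qrealM.
by rewrite !mulrA -!qrealM -mulrA (mulrC s) -mulrA ss /qreal mul1r.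
Qed.

Lemma rotate_to_complex p : exists2 u, qnorm2 u = 1 &
  qconj u * p * u = (qre p, Num.sqrt (qim_norm2 p), 0, 0).
Proof.
set k := Num.sqrt _.
have kk : k ^+ 2 = qim_norm2 p by rewrite sqr_sqrtr ?qim_norm2_ge0.
(* With [v] the imaginary part of [p], the conjugator is [k - v i], which works because
   [v ^ 2 = - k ^ 2]. It vanishes only for [v = - k i], and then [j] is a conjugator. *)
have [q0|q0] := eqVneq ((k + qim_i p, 0, - qim_k p, qim_j p) : quat R) 0.
  have pk : qim_k p = 0.
    by have := congr1 qim_j q0; rewrite !quatE => /eqP; rewrite oppr_eq0 => /eqP.
  have pj : qim_j p = 0 by have := congr1 qim_k q0; rewrite !quatE.
  have pi : qim_i p = - k.
    by have := congr1 qre q0; rewrite !quatE => /eqP; rewrite addr_eq0 => /eqP ->; rewrite opprK.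
  apply: (@unit_conjugator _ _ (0, 0, 1, 0)).
    by apply/eqP => /(congr1 qim_j)/eqP; rewrite !quatE oner_eq0.
  by apply: quatP; rewrite !quatE ?pi ?pj ?pk; ring.
apply: unit_conjugator q0 _.
by apply: quatP; rewrite !quatE; move: kk; rewrite /qim_norm2 => kk; try ring; nra.
Qed.

(* [r] is the upper right entry of a skew-Hermitian matrix with
   diagonal [p, s]; the pair [(c, z)] is a traceless Hermitian matrix
   commuting with it, whose eigenvectors therefore diagonalise it. *)
Lemma commuting_hermitian (p s r : quat R) : qre p = 0 -> qre s = 0 ->
  exists (c : R) (z : quat R), [/\ 0 <= c, 0 < c ^+ 2 + qnorm2 z,
    p * z - z * s = qreal (2 * c) * r & qre (qconj r * z) = 0].
Proof.
move=> p0 s0; have [->|r0] := eqVneq r 0.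
  exists 1, 0; split => //; first by rewrite ltr_pwDl ?qnorm2_ge0// expr1n ltr01.
    by rewrite mulr0 mul0r mulr0 subrr.
  by rewrite mulr0.
(* Minus the traceless part of the square of the skew-Hermitian matrix: the square is Hermitian and
   commutes with the matrix. *)
pose c := (qnorm2 p - qnorm2 s) / 2; pose z := - (p * r + r * s).
have pz : p * z - z * s = qreal (2 * c) * r.
  by apply: quatP; rewrite /c /z /qnorm2 !quatE p0 s0; field.
have rz : qre (qconj r * z) = 0 by rewrite /z !quatE p0 s0; ring.
have [cz|cz] := ltP 0 (c ^+ 2 + qnorm2 z).
  have [c0|c0] := leP 0 c; first by exists c, z.
  exists (- c), (- z); split.
  - by rewrite oppr_ge0 ltW.
  - by rewrite sqrrN; congr (_ < _ + _): cz; rewrite /qnorm2 !quatE; ring.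
  - have -> : p * - z - - z * s = - (p * z - z * s).
      by rewrite mulrN mulNr opprK opprB addrC.
    by rewrite pz; apply: quatP; rewrite !quatE; ring.
  - by rewrite mulrN qreN rz oppr0.
have z0 : z = 0.
  apply: qnorm2_eq0; apply/le_anti; rewrite qnorm2_ge0 andbT.
  by have := sqr_ge0 c; lra.
(* Here the square is scalar, so [p r = - r s]. An imaginary [y] anticommuting with [p] then gives a
   commuting matrix with zero diagonal and off-diagonal entry [y r]. *)
have [y [y0 yre py]] : exists y : quat R, [/\ y != 0, qre y = 0 & p * y = - (y * p)].
  have [pij|pij] := eqVneq (qim_i p ^+ 2 + qim_j p ^+ 2) 0.
    exists (0, 1, 0, 0); split => //.
      by apply/eqP => /(congr1 qim_i)/eqP; rewrite !quatE oner_eq0.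
    have := sqr_ge0 (qim_i p); have := sqr_ge0 (qim_j p) => h1 h2.
    have pi : qim_i p = 0 by apply/eqP; rewrite -sqrf_eq0; apply/eqP; lra.
    have pj : qim_j p = 0 by apply/eqP; rewrite -sqrf_eq0; apply/eqP; lra.
    by apply: quatP; rewrite !quatE p0 pi pj; ring.
  exists (0, - qim_j p, qim_i p, 0); split => //.
    apply: contra_neq pij => y0.
    have := congr1 qim_i y0; have := congr1 qim_j y0; rewrite !quatE => -> /eqP.
    by rewrite oppr_eq0 => /eqP ->; rewrite !expr0n addr0.
  by apply: quatP; rewrite !quatE p0; ring.
exists 0, (y * r); split => //.
- by rewrite expr0n add0r qnorm2M mulr_gt0 ?qnorm2_gt0.
- have rs : r * s = - (p * r).
    by apply/eqP; rewrite -addr_eq0 addrC -oppr_eq0 -/z z0.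
  rewrite -mulrA rs mulrN opprK !mulrA py mulNr addNr mulr0.
  by apply: quatP; rewrite !quatE; ring.
- by rewrite !quatE yre; ring.
Qed.

(* The left-hand side is the off-diagonal entry, in the basis
   [(m, conj z), (- z, m)], of [w - w^H] for [w = (a, b; c, d)]. *)
Lemma skew_form_identity (m : R) (z a b c d : quat R) :
  let M := qreal m in
  qconj (- z) * (a * M + b * qconj z) + qconj M * (c * M + d * qconj z) -
  qconj (qconj M * (a * - z + b * M) + qconj (qconj z) * (c * - z + d * M)) =
  M * qconj ((a - qconj a) * z - z * (d - qconj d))
  - (qconj (qconj (b - qconj c) * z) + qconj (b - qconj c) * z) * qconj z
  + qconj (b - qconj c) * qreal (qnorm2 z - m ^+ 2).
Proof. by move=> M; apply: quatP; rewrite /M /qnorm2 !quatE; ring. Qed.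

End QuaternionAlgebra.

(** * Averaging rank one matrices in dimension two *)

Section PlanarLemmas.
Context {R : realType}.
Implicit Types (t k l m y a b : R) (p q x z : quat R).

(** Moving a point of the disc orthogonally to [(h0, h1)] keeps the functional fixed and eventually
    meets the circle. *)
Lemma push_to_circle (h0 h1 z0 z1 r : R) : z0 ^+ 2 + z1 ^+ 2 <= r ->
  exists w0 w1, w0 ^+ 2 + w1 ^+ 2 = r /\ h0 * w0 + h1 * w1 = h0 * z0 + h1 * z1.
Proof.
move=> zr.
have [d0 [d1 [dd dh]]] : exists d0 d1, 0 < d0 ^+ 2 + d1 ^+ 2 /\ h0 * d0 + h1 * d1 = 0.
  have [h|h] := eqVneq (h0 ^+ 2 + h1 ^+ 2) 0.
    have := sqr_ge0 h0; have := sqr_ge0 h1 => h1p h0p.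
    have e0 : h0 = 0 by apply/eqP; rewrite -sqrf_eq0; apply/eqP; lra.
    have e1 : h1 = 0 by apply/eqP; rewrite -sqrf_eq0; apply/eqP; lra.
    by exists 1, 0; rewrite e0 e1; split; [rewrite expr1n expr0n addr0 ltr01 | rewrite !mul0r addr0].
  exists (- h1), h0; split; last by ring.
  by rewrite lt_neqAle sqrrN addrC eq_sym h addr_ge0 ?sqr_ge0.
pose D := d0 ^+ 2 + d1 ^+ 2; pose B := z0 * d0 + z1 * d1.
pose C := r - (z0 ^+ 2 + z1 ^+ 2).
pose S := Num.sqrt (B ^+ 2 + D * C).
have SS : S ^+ 2 = B ^+ 2 + D * C.
  by rewrite sqr_sqrtr// addr_ge0 ?sqr_ge0// mulr_ge0 ?subr_ge0// ltW.
(* A root of [D t^2 + 2 B t = C]; the discriminant is nonnegative because [C >= 0]. *)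
pose t := (- B + S) / D.
have Dt : D * t = - B + S by rewrite /t mulrC divfK// gt_eqF.
exists (z0 + t * d0), (z1 + t * d1); split.
  have -> : (z0 + t * d0) ^+ 2 + (z1 + t * d1) ^+ 2 =
     z0 ^+ 2 + z1 ^+ 2 + t * (D * t + 2 * B) by rewrite /D /B; ring.
  have -> : t * (D * t + 2 * B) = C; last by rewrite /C; ring.
  apply: (mulfI (lt0r_neq0 dd)); rewrite -/D mulrA Dt.
  by transitivity (S ^+ 2 - B ^+ 2); [ring | rewrite SS; ring].
by rewrite -[RHS]addr0 -(mulr0 t) -dh; ring.
Qed.

(** Cauchy-Schwarz for the positive semidefinite form [m^2 + k (a^2 + b^2)]. *)
Lemma cauchy_schwarz3 k (m m' a a' b b' y y' : R) : 0 <= k -> 0 <= y -> 0 <= y' ->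
  m ^+ 2 + k * (a ^+ 2 + b ^+ 2) <= y ^+ 2 ->
  m' ^+ 2 + k * (a' ^+ 2 + b' ^+ 2) <= y' ^+ 2 ->
  m * m' + k * (a * a' + b * b') <= y * y'.
Proof.
move=> k0 y0 y'0 h h'; apply: le_trans (ler_norm _) _.
rewrite -(@ler_pXn2r _ 2)// ?nnegrE ?mulr_ge0// real_normK ?num_real//.
have hp := sqr_ge0 m; have n0 c d : 0 <= k * (c ^+ 2 + d ^+ 2).
  by rewrite mulr_ge0// addr_ge0 ?sqr_ge0.
apply: (@le_trans _ _ ((m ^+ 2 + k * (a ^+ 2 + b ^+ 2)) *
    (m' ^+ 2 + k * (a' ^+ 2 + b' ^+ 2)))); last first.
  by rewrite exprMn ler_pM// addr_ge0 ?sqr_ge0.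
(* The defect in the Cauchy-Schwarz inequality, by Lagrange's identity. *)
have : 0 <= k * ((m * a' - m' * a) ^+ 2 + (m * b' - m' * b) ^+ 2) +
   (k * (a * b' - a' * b)) ^+ 2 by rewrite addr_ge0 ?sqr_ge0.
by move=> h0; rewrite -subr_ge0; apply: (eq_ind _ (>= 0) h0); ring.
Qed.

Lemma sqr_avg_le k t (m m' a a' b b' y y' : R) : 0 <= k -> 0 <= y -> 0 <= y' ->
  0 <= t <= 1 ->
  m ^+ 2 + k * (a ^+ 2 + b ^+ 2) <= y ^+ 2 ->
  m' ^+ 2 + k * (a' ^+ 2 + b' ^+ 2) <= y' ^+ 2 ->
  (t * m + (1 - t) * m') ^+ 2 + k * ((t * a + (1 - t) * a') ^+ 2 +
    (t * b + (1 - t) * b') ^+ 2) <= (t * y + (1 - t) * y') ^+ 2.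
Proof.
move=> k0 y0 y'0 /andP[t0 t1] h h'; have cs := cauchy_schwarz3 k0 y0 y'0 h h'.
have s0 : 0 <= 1 - t by lra.
have e1 := ler_wpM2l (sqr_ge0 t) h; have e2 := ler_wpM2l (sqr_ge0 (1 - t)) h'.
have e3 := ler_wpM2l (mulr_ge0 t0 s0) cs.
move: e1 e2 e3; rewrite -subr_ge0 => e1; rewrite -subr_ge0 => e2.
rewrite -subr_ge0 => e3; rewrite -subr_ge0.
have := addr_ge0 (addr_ge0 e1 e2) (addr_ge0 e3 e3).
by move=> h0; apply: (eq_ind _ (>= 0) h0); ring.
Qed.

(* The frame puts the numerical range in the form
   [h1 |x1|^2 + h2 |x2|^2 + 2 Re (g x2 conj(x1))] for its real part and
   [conj(x1) (k1 i) x1 + conj(x2) (k2 i) x2] for its imaginary part. With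
   [z = x2 conj(x1) = a + b j], a and b complex, the squared norm of the latter is
   [(k1 |x1|^2 - k2 |x2|^2)^2 + 4 k1 k2 |a|^2] and
   [(k1 |x1|^2 + k2 |x2|^2)^2 - 4 k1 k2 |b|^2]. *)
Lemma frame_real_average (k1 k2 t g0 g1 g2 g3 : R)
    (a b z0 z1 z2 z3 y a' b' z0' z1' z2' z3' y' : R) :
  0 <= k1 -> 0 <= k2 -> 0 <= t <= 1 ->
  0 <= a -> 0 <= b -> 0 <= y -> 0 <= a' -> 0 <= b' -> 0 <= y' ->
  z0 ^+ 2 + z1 ^+ 2 + (z2 ^+ 2 + z3 ^+ 2) = a * b ->
  z0' ^+ 2 + z1' ^+ 2 + (z2' ^+ 2 + z3' ^+ 2) = a' * b' ->
  y ^+ 2 = (k1 * a - k2 * b) ^+ 2 + 4 * k1 * k2 * (z0 ^+ 2 + z1 ^+ 2) ->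
  y' ^+ 2 = (k1 * a' - k2 * b') ^+ 2 + 4 * k1 * k2 * (z0' ^+ 2 + z1' ^+ 2) ->
  let A := t * a + (1 - t) * a' in let B := t * b + (1 - t) * b' in
  exists w0 w1 w2 w3, [/\ w0 ^+ 2 + w1 ^+ 2 + (w2 ^+ 2 + w3 ^+ 2) = A * B,
    g0 * w0 + g1 * w1 + (g2 * w2 + g3 * w3) =
      t * (g0 * z0 + g1 * z1 + (g2 * z2 + g3 * z3)) +
      (1 - t) * (g0 * z0' + g1 * z1' + (g2 * z2' + g3 * z3')) &
    (t * y + (1 - t) * y') ^+ 2 =
      (k1 * A - k2 * B) ^+ 2 + 4 * k1 * k2 * (w0 ^+ 2 + w1 ^+ 2)].
Proof.
move=> k10 k20 t01 a0 b0 y0 a'0 b'0 y'0 zab z'ab yE y'E A B.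
have /andP[t0 t1] := t01; have s0 : 0 <= 1 - t by lra.
pose Z i j := t * i + (1 - t) * j.
(* The average of two positive semidefinite matrices is positive semidefinite, so its determinant is
   nonnegative. *)
have zAB : Z z0 z0' ^+ 2 + Z z1 z1' ^+ 2 + (Z z2 z2' ^+ 2 + Z z3 z3' ^+ 2) <= A * B.
  have sum0 (c0 c1 c2 c3 : R) : c0 ^+ 2 + c1 ^+ 2 + (c2 ^+ 2 + c3 ^+ 2) = 0 ->
      [/\ c0 = 0, c1 = 0, c2 = 0 & c3 = 0].
    move=> c; have : ((c0, c1, c2, c3) : quat R) = 0.
      by apply: qnorm2_eq0; rewrite /qnorm2 !quatE -addrA.
    by case.
  have am : 2 * (z0 * z0' + z1 * z1' + (z2 * z2' + z3 * z3')) <= a * b' + a' * b.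
    have ge0 : 0 <= a * b' + a' * b by rewrite addr_ge0 ?mulr_ge0.
    have [aa|aa] := eqVneq (a * a') 0.
      suff -> : z0 * z0' + z1 * z1' + (z2 * z2' + z3 * z3') = 0 by rewrite mulr0.
      move: aa => /eqP; rewrite mulf_eq0 => /orP[] /eqP e0.
        by move: zab; rewrite e0 mul0r => /sum0[-> -> -> ->]; rewrite !mul0r !addr0.
      by move: z'ab; rewrite e0 mul0r => /sum0[-> -> -> ->]; rewrite !mulr0 !addr0.
    have aa0 : 0 < a * a' by rewrite lt_neqAle eq_sym aa mulr_ge0.
    rewrite -subr_ge0 -(pmulr_rge0 _ aa0).
    have -> : a * a' * (a * b' + a' * b - 2 * (z0 * z0' + z1 * z1' + (z2 * z2' + z3 * z3')))
      = (a * z0' - a' * z0) ^+ 2 + (a * z1' - a' * z1) ^+ 2 +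
        ((a * z2' - a' * z2) ^+ 2 + (a * z3' - a' * z3) ^+ 2).
      transitivity (a ^+ 2 * (a' * b') + a' ^+ 2 * (a * b) -
        2 * a * a' * (z0 * z0' + z1 * z1' + (z2 * z2' + z3 * z3'))); first by ring.
      by rewrite -zab -z'ab; ring.
    by rewrite !addr_ge0 ?sqr_ge0.
  rewrite -subr_ge0; move: (mulr_ge0 (mulr_ge0 t0 s0) (etrans (subr_ge0 _ _) am)).
  have -> : A * B = t ^+ 2 * (a * b) + (1 - t) ^+ 2 * (a' * b') +
      t * (1 - t) * (a * b' + a' * b) by rewrite /A /B; ring.
  by rewrite -zab -z'ab => h0; apply: (eq_ind _ (>= 0) h0); rewrite /Z; ring.
pose Y := t * y + (1 - t) * y'.
(* The Euclidean formula for [y] bounds [Y] from below. The Lorentzian one bounds it from above in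
   [hi], where [y] becomes a coordinate and [k1 a + k2 b] the bound in the same triangle
   inequality. *)
have lo : (k1 * A - k2 * B) ^+ 2 + 4 * k1 * k2 * (Z z0 z0' ^+ 2 + Z z1 z1' ^+ 2) <= Y ^+ 2.
  have -> : k1 * A - k2 * B = Z (k1 * a - k2 * b) (k1 * a' - k2 * b').
    by rewrite /Z /A /B; ring.
  by apply: sqr_avg_le; rewrite ?yE ?y'E// !mulr_ge0.
have hi : Y ^+ 2 + 4 * k1 * k2 * (Z z2 z2' ^+ 2 + Z z3 z3' ^+ 2) <=
    (k1 * A + k2 * B) ^+ 2.
  have -> : k1 * A + k2 * B = Z (k1 * a + k2 * b) (k1 * a' + k2 * b').
    by rewrite /Z /A /B; ring.
  apply: sqr_avg_le; rewrite ?addr_ge0 ?mulr_ge0// ?yE ?y'E.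
    by rewrite -addrA -mulrDr zab -subr_ge0 le_eqVlt; apply/orP; left; apply/eqP; ring.
  by rewrite -addrA -mulrDr z'ab -subr_ge0 le_eqVlt; apply/orP; left; apply/eqP; ring.
(* The squared norms that the C and Cj parts must reach for rank one and imaginary norm [Y]; [lo]
   and [hi] say that neither part has to shrink. If [k1 k2 = 0], the imaginary norm does not see the
   off-diagonal entry, and the Cj part takes all the slack. *)
have [rC [rJ [zC zJ rCJ rE]]] : exists rC rJ,
    [/\ Z z0 z0' ^+ 2 + Z z1 z1' ^+ 2 <= rC, Z z2 z2' ^+ 2 + Z z3 z3' ^+ 2 <= rJ,
     rC + rJ = A * B & Y ^+ 2 = (k1 * A - k2 * B) ^+ 2 + 4 * k1 * k2 * rC].
  have [k0|k0] := eqVneq (k1 * k2) 0.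
    exists (Z z0 z0' ^+ 2 + Z z1 z1' ^+ 2), (A * B - (Z z0 z0' ^+ 2 + Z z1 z1' ^+ 2)).
    split => //; [by rewrite lerBrDl | by rewrite addrC subrK|].
    move: lo hi; rewrite -(mulrA 4) k0 mulr0 !mul0r !addr0 => lo hi.
    apply/le_anti; rewrite lo andbT (le_trans hi)// -subr_ge0 le_eqVlt.
    apply/orP; left; apply/eqP; transitivity (- (4 * (k1 * k2) * (A * B))); last by ring.
    by rewrite k0; ring.
  have k4 : 0 < 4 * k1 * k2.
    by rewrite -mulrA mulr_gt0// lt_neqAle eq_sym k0 mulr_ge0.
  exists ((Y ^+ 2 - (k1 * A - k2 * B) ^+ 2) / (4 * k1 * k2)),
    (((k1 * A + k2 * B) ^+ 2 - Y ^+ 2) / (4 * k1 * k2)); split.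
  - by rewrite ler_pdivlMr// mulrC; lra.
  - by rewrite ler_pdivlMr// mulrC; lra.
  - by rewrite -mulrDl; apply: (mulIf (lt0r_neq0 k4)); rewrite divfK ?gt_eqF//; ring.
  - by rewrite [_ * (_ / _)]mulrC divfK ?gt_eqF//; ring.
have [w0 [w1 [wC gC]]] := push_to_circle g0 g1 zC.
have [w2 [w3 [wJ gJ]]] := push_to_circle g2 g3 zJ.
exists w0, w1, w2, w3; split; first by rewrite wC wJ.
  by rewrite gC gJ /Z; ring.
by rewrite wC.
Qed.

(** All quantities depend on a pair [(u1, u2)] only through the rank one matrix with diagonal
    [|u1|^2], [|u2|^2] and off-diagonal entry [u2 conj(u1)], which reduces the claim to real
    coordinates. *)
Lemma frame_average k1 k2 t (g x1 x2 y1 y2 : quat R) :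
  0 <= k1 -> 0 <= k2 -> 0 <= t <= 1 ->
  let im (u1 u2 : quat R) := qim_norm2 (qconj u1 * (0, k1, 0, 0) * u1
                                      + qconj u2 * (0, k2, 0, 0) * u2) in
  exists z1 z2 : quat R,
    [/\ qnorm2 z1 = t * qnorm2 x1 + (1 - t) * qnorm2 y1,
        qnorm2 z2 = t * qnorm2 x2 + (1 - t) * qnorm2 y2,
        qre (qconj z1 * g * z2) =
          t * qre (qconj x1 * g * x2) + (1 - t) * qre (qconj y1 * g * y2) &
        Num.sqrt (im z1 z2) = t * Num.sqrt (im x1 x2) + (1 - t) * Num.sqrt (im y1 y2)].
Proof.
move=> k10 k20 t01 im; have /andP[t0 t1] := t01.
have imE u1 u2 : im u1 u2 = (k1 * qnorm2 u1 - k2 * qnorm2 u2) ^+ 2 +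
    4 * k1 * k2 * (qre (u2 * qconj u1) ^+ 2 + qim_i (u2 * qconj u1) ^+ 2).
  by rewrite /im /qim_norm2 /qnorm2 !quatE; ring.
have gE (u1 u2 : quat R) : qre (qconj u1 * g * u2) =
   let z := u2 * qconj u1 in
   qre g * qre z + (- qim_i g) * qim_i z + ((- qim_j g) * qim_j z + (- qim_k g) * qim_k z).
  by rewrite /= !quatE; ring.
have nE (u1 u2 : quat R) : let z := u2 * qconj u1 in
  qre z ^+ 2 + qim_i z ^+ 2 + (qim_j z ^+ 2 + qim_k z ^+ 2) = qnorm2 u1 * qnorm2 u2.
  by rewrite /= -(qnorm2_conj u1) mulrC -qnorm2M /qnorm2 addrA.
have im0 u1 u2 : 0 <= im u1 u2 by exact: qim_norm2_ge0.
have sE u1 u2 := sqr_sqrtr (im0 u1 u2).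
have [w0 [w1 [w2 [w3 [wN wg wY]]]]] := @frame_real_average k1 k2 t
  (qre g) (- qim_i g) (- qim_j g) (- qim_k g) _ _ _ _ _ _ _ _ _ _ _ _ _ _
  k10 k20 t01 (qnorm2_ge0 x1) (qnorm2_ge0 x2) (sqrtr_ge0 (im x1 x2))
  (qnorm2_ge0 y1) (qnorm2_ge0 y2) (sqrtr_ge0 (im y1 y2)) (nE x1 x2) (nE y1 y2)
  (etrans (sE _ _) (imE _ _)) (etrans (sE _ _) (imE _ _)).
set A := t * qnorm2 x1 + _ in wN wY *; set B := t * qnorm2 x2 + _ in wN wY *.
have s0 : 0 <= 1 - t by lra.
have A0 : 0 <= A by rewrite addr_ge0// mulr_ge0// qnorm2_ge0.
have B0 : 0 <= B by rewrite addr_ge0// mulr_ge0// qnorm2_ge0.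
have wqN : qnorm2 (w0, w1, w2, w3) = A * B by rewrite -wN /qnorm2 !quatE addrA.
(* Factor the rank one matrix: [z1] is the square root of [A], and [z2] is the off-diagonal entry
   divided by it. If [A = 0], that entry vanishes and [z1 = 0] will do. *)
have [z1 [z2 [z1N z2N zE]]] : exists z1 z2 : quat R,
    [/\ qnorm2 z1 = A, qnorm2 z2 = B & z2 * qconj z1 = (w0, w1, w2, w3)].
  have [A00|Ane0] := eqVneq A 0.
    exists 0, (qreal (Num.sqrt B)); rewrite qnorm2_real sqr_sqrtr//; split => //.
      by rewrite A00 /qnorm2 !quatE expr0n !addr0.
    by rewrite qconj0 mulr0; apply/esym/qnorm2_eq0; rewrite wqN A00 mul0r.
  have sA0 : Num.sqrt A != 0 by rewrite sqrtr_eq0 -ltNge lt_neqAle eq_sym Ane0.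
  have sAA := sqr_sqrtr A0.
  exists (qreal (Num.sqrt A)), (((w0, w1, w2, w3) : quat R) * qreal (Num.sqrt A)^-1).
  rewrite qnorm2M !qnorm2_real wqN sqr_sqrtr//; split => //.
    by rewrite exprVn sqr_sqrtr// mulrAC divff// mul1r.
  by rewrite qconj_real -mulrA -qrealM mulVf// /qreal mulr1.
exists z1, z2; split => //; first by rewrite !gE zE; exact: wg.
rewrite imE zE z1N z2N !quatE -wY sqrtr_sqr ger0_norm//.
by rewrite addr_ge0// mulr_ge0// sqrtr_ge0.
Qed.

End PlanarLemmas.

(** * Inner product and right scalar multiplication *)

Section InnerProduct.
Context {R : realType} {V : quatHilbertType R}.
Implicit Types (x y z : V) (p q : quat R) (r : R).

Lemma rscaleA x p q : x *> p *> q = x *> (p * q).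
Proof. exact: (@scalerA (quatc R) V). Qed.

Lemma rscaleDr x p q : x *> (p + q) = x *> p + x *> q.
Proof. exact: (@scalerDl (quatc R) V). Qed.

Lemma rscaleDl x y q : (x + y) *> q = x *> q + y *> q.
Proof. exact: (@scalerDr (quatc R) V). Qed.

Lemma rscale1 x : x *> (1 : quat R) = x.
Proof. exact: (@scale1r (quatc R) V). Qed.

Lemma rscale0 x : x *> (0 : quat R) = 0.
Proof. exact: (@scale0r (quatc R) V). Qed.

Lemma ipDr x y z : ip x (y + z) = ip x y + ip x z.
Proof. by rewrite ipC ipDl qconjD -!ipC. Qed.

Lemma ipZr x q z : ip x (z *> q) = qconj q * ip x z.
Proof. by rewrite ipC ipZl qconjM -ipC. Qed.

Lemma ip0l x : ip 0 x = 0.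
Proof. by apply: (addrI (ip 0 x)); rewrite -ipDl !addr0. Qed.

Lemma ip0r x : ip x 0 = 0.
Proof. by rewrite ipC ip0l qconj0. Qed.

Lemma ipNl x y : ip (- x) y = - ip x y.
Proof. by apply/eqP; rewrite -addr_eq0 -ipDl addNr ip0l. Qed.

Lemma ipNr x y : ip x (- y) = - ip x y.
Proof. by rewrite ipC ipNl qconjN -ipC. Qed.

Lemma ip_real x : ip x x = qreal (qre (ip x x)).
Proof.
have := ipC x x; set q := ip x x => h.
have := congr1 qim_i h; have := congr1 qim_j h; have := congr1 qim_k h.
by rewrite !quatE => hk hj hi; apply: quatP; rewrite !quatE//; lra.
Qed.

Lemma ip_ge0 x : 0 <= qre (ip x x).
Proof. by have [->|/ip_gt0/ltW//] := eqVneq x 0; rewrite ip0l. Qed.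

Lemma hnorm_ge0 x : 0 <= hnorm x. Proof. exact: sqrtr_ge0. Qed.

Lemma hnorm_sqr x : hnorm x ^+ 2 = qre (ip x x).
Proof. by rewrite sqr_sqrtr ?ip_ge0. Qed.

Lemma hnorm_gt0 x : x != 0 -> 0 < hnorm x.
Proof. by move=> /ip_gt0; rewrite -sqrtr_gt0. Qed.

Lemma hnorm1P x : hnorm x = 1 <-> ip x x = 1.
Proof.
split => [h|h]; last by rewrite /hnorm h sqrtr1.
by rewrite ip_real -hnorm_sqr h expr1n.
Qed.

Lemma ip_scale x q : ip (x *> q) (x *> q) = ip x x * qreal (qnorm2 q).
Proof.
by rewrite ipZl ipZr ip_real -qreal_comm -mulrA qmul_conjl.
Qed.

Lemma hnorm_scale x q : hnorm (x *> q) = hnorm x * Num.sqrt (qnorm2 q).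
Proof.
rewrite /hnorm ip_scale (_ : qre _ = qre (ip x x) * qnorm2 q) ?sqrtrM ?ip_ge0//.
by rewrite ip_real !quatE; ring.
Qed.

Lemma hnorm_scale_unit x q : qnorm2 q = 1 -> hnorm (x *> q) = hnorm x.
Proof. by move=> q1; rewrite hnorm_scale q1 sqrtr1 mulr1. Qed.

Lemma normalize x : x != 0 -> exists2 r, 0 < r & hnorm (x *> qreal r) = 1.
Proof.
move=> x0; have n0 := hnorm_gt0 x0; exists (hnorm x)^-1; first by rewrite invr_gt0.
by rewrite hnorm_scale qnorm2_real sqrtr_sqr gtr0_norm ?invr_gt0// mulfV ?gt_eqF.
Qed.

Lemma ip_scale_real r x y :
  ip (x *> qreal r) (y *> qreal r) = ip x y * qreal (r * r).
Proof. by rewrite ipZl ipZr qconj_real qreal_comm -mulrA -qrealM. Qed.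

Lemma quat_form (T : {linear V -> V}) x q :
  ip (T (x *> q)) (x *> q) = qconj q * ip (T x) x * q.
Proof. by rewrite linearZ ipZl ipZr. Qed.

End InnerProduct.

(** * Two-dimensional frames diagonalising the skew-Hermitian part *)

Section Frames.
Context {R : realType} {V : quatHilbertType R} (T : {linear V -> V}).
Implicit Types (x y z e f : V) (p q : quat R) (r : R).

Definition orthonormal2 f1 f2 : Prop :=
  [/\ ip f1 f1 = 1, ip f2 f2 = 1 & ip f1 f2 = 0].

Definition span2 f1 f2 : set V := [set x | exists a b : quat R, x = f1 *> a + f2 *> b].

Lemma comb_comb f1 f2 (a b c d u v : quat R) :
  (f1 *> a + f2 *> b) *> u + (f1 *> c + f2 *> d) *> v =
  f1 *> (a * u + c * v) + f2 *> (b * u + d * v).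
Proof. by rewrite !rscaleDl !rscaleA !rscaleDr addrACA. Qed.

Lemma span2_trans e1 e2 f1 f2 x : span2 f1 f2 e1 -> span2 f1 f2 e2 ->
  span2 e1 e2 x -> span2 f1 f2 x.
Proof.
move=> [a [b ->]] [c [d ->]] [u [v ->]].
by exists (a * u + c * v), (b * u + d * v); rewrite comb_comb.
Qed.

Lemma ip_comb f1 f2 (a1 a2 b1 b2 : quat R) :
  ip (f1 *> a1 + f2 *> a2) (f1 *> b1 + f2 *> b2) =
  qconj b1 * (ip f1 f1 * a1 + ip f2 f1 * a2) +
  qconj b2 * (ip f1 f2 * a1 + ip f2 f2 * a2).
Proof. by rewrite ipDl !ipDr !ipZl !ipZr !mulrDr !mulrA [RHS]addrACA. Qed.

Lemma form_comb f1 f2 (a1 a2 b1 b2 : quat R) :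
  ip (T (f1 *> a1 + f2 *> a2)) (f1 *> b1 + f2 *> b2) =
  qconj b1 * (ip (T f1) f1 * a1 + ip (T f2) f1 * a2) +
  qconj b2 * (ip (T f1) f2 * a1 + ip (T f2) f2 * a2).
Proof.
by rewrite linearD !linearZ ipDl !ipDr !ipZl !ipZr !mulrDr !mulrA addrACA.
Qed.

Lemma ip_orthonormal2 f1 f2 (a1 a2 b1 b2 : quat R) : orthonormal2 f1 f2 ->
  ip (f1 *> a1 + f2 *> a2) (f1 *> b1 + f2 *> b2) = qconj b1 * a1 + qconj b2 * a2.
Proof.
move=> [f11 f22 f12]; rewrite ip_comb f11 f22 f12 (ipC f2) f12 qconj0.
by rewrite !mul0r !mul1r addr0 add0r.
Qed.

(** The last conclusion says that the skew-Hermitian part of [T] is diagonal in the frame, which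
    consists of normalised eigenvectors of a Hermitian matrix commuting with that part. *)
Lemma exists_diagonal_frame e1 e2 : orthonormal2 e1 e2 ->
  exists f1 f2, [/\ orthonormal2 f1 f2, span2 f1 f2 e1, span2 f1 f2 e2 &
    ip (T f2) f1 = qconj (ip (T f1) f2)].
Proof.
move=> eo; pose W11 := ip (T e1) e1; pose W22 := ip (T e2) e2.
pose W12 := ip (T e2) e1; pose W21 := ip (T e1) e2.
pose p := W11 - qconj W11; pose s := W22 - qconj W22; pose r := W12 - qconj W21.
have p0 : qre p = 0 by rewrite /p !quatE subrr.
have s0 : qre s = 0 by rewrite /s !quatE subrr.
have [c [z [c0 cz hz hr]]] := commuting_hermitian r p0 s0.
(* The eigenvalues of [(c, z; conj z, - c)] are [rho] and [- rho], with eigenvectors [(m, conj z)]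
   and [(- z, m)]; [c >= 0] gives [m > 0], so neither is zero. *)
pose rho := Num.sqrt (c ^+ 2 + qnorm2 z); pose m := c + rho.
have rho0 : 0 < rho by rewrite sqrtr_gt0.
have m0 : 0 < m by rewrite /m ltr_wpDl.
have mm : m ^+ 2 = 2 * c * m + qnorm2 z.
  have : rho ^+ 2 = c ^+ 2 + qnorm2 z by rewrite sqr_sqrtr// ltW.
  by rewrite /m => h; transitivity (c ^+ 2 + 2 * c * rho + rho ^+ 2);
    [ring | rewrite h; ring].
pose N := m ^+ 2 + qnorm2 z.
have N0 : 0 < N by rewrite ltr_pwDl ?qnorm2_ge0// exprn_gt0.
pose S := (Num.sqrt N)^-1.
have SS : S * S * N = 1.
  by rewrite -{1}(sqr_sqrtr (ltW N0)) /S; field; rewrite sqrtr_eq0 -ltNge.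
pose M := qreal m : quat R.
have Mz q : M * q = q * M by exact: qreal_comm.
have MM : M * M + qconj z * z = qreal N.
  by rewrite -qrealM qmul_conjl /N; apply: quatP; rewrite !quatE; ring.
have MM' : M * M + z * qconj z = qreal N.
  by rewrite qmul_conjr -qmul_conjl.
pose F1 := e1 *> M + e2 *> qconj z; pose F2 := e1 *> (- z) + e2 *> M.
have F11 : ip F1 F1 = qreal N.
  by rewrite ip_orthonormal2// qconjK qconj_real -/M MM'.
have F22 : ip F2 F2 = qreal N.
  by rewrite ip_orthonormal2// qconjN mulrNN qconj_real addrC -/M MM.
have F12 : ip F1 F2 = 0.
  by rewrite ip_orthonormal2// qconjN qconj_real -/M Mz mulNr addNr.
have SN : qreal N * qreal (S * S) = 1 :> quat R by rewrite -qrealM mulrC SS.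
have e1E : e1 = F1 *> (M * qreal (S * S)) + F2 *> (- qconj z * qreal (S * S)).
  rewrite comb_comb !mulrA -!mulrDl mulrN mulNr opprK MM' SN.
  by rewrite mulrN Mz subrr mul0r rscale1 rscale0 addr0.
have e2E : e2 = F1 *> (z * qreal (S * S)) + F2 *> (M * qreal (S * S)).
  rewrite comb_comb !mulrA -!mulrDl mulNr Mz subrr mul0r.
  by rewrite addrC -/M (addrC _ (M * M)) MM SN rscale1 rscale0 addr0.
have SSq q : qreal S * (q * qreal S) = q * qreal (S * S).
  by rewrite qreal_comm -mulrA -qrealM.
exists (F1 *> qreal S), (F2 *> qreal S); split.
- by split; rewrite ip_scale_real ?F11 ?F22 ?F12 ?SN// mul0r.
- exists (M * qreal S), (- qconj z * qreal S).
  by rewrite !rscaleA !SSq -e1E.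
- exists (z * qreal S), (M * qreal S).
  by rewrite !rscaleA !SSq -e2E.
rewrite !linearZ !ip_scale_real qconjM qconj_real -qreal_comm; congr (_ * _).
suff key : ip (T F1) F2 - qconj (ip (T F2) F1) = 0.
  by have /eqP := key; rewrite subr_eq0 => /eqP ->; rewrite qconjK.
have -> : ip (T F1) F2 - qconj (ip (T F2) F1) =
    M * qconj (p * z - z * s) - (qconj (qconj r * z) + qconj r * z) * qconj z
    + qconj r * qreal (qnorm2 z - m ^+ 2).
  by rewrite !form_comb skew_form_identity.
have -> : qconj (qconj r * z) + qconj r * z = 0.
  by apply: quatP; rewrite [LHS]quatE qcomp_conj ?hr ?addr0 ?addNr.
(* The two terms left are [2 c m conj(r)] and its negative. *)
rewrite hz mul0r subr0 qconjM qconj_real mm /M.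
by apply: quatP; rewrite !quatE; ring.
Qed.

(** A unit right factor on each frame vector rotates its diagonal entry into the closed upper
    half-plane and preserves the relation between the off-diagonal entries. *)
Lemma exists_frame e1 e2 : orthonormal2 e1 e2 ->
  exists f1 f2 k1 k2, [/\ orthonormal2 f1 f2 /\ (0 <= k1 /\ 0 <= k2),
    span2 f1 f2 e1, span2 f1 f2 e2, ip (T f2) f1 = qconj (ip (T f1) f2) &
    exists h1 h2, ip (T f1) f1 = (h1, k1, 0, 0) /\ ip (T f2) f2 = (h2, k2, 0, 0)].
Proof.
move=> /exists_diagonal_frame[f1 [f2 [[f11 f22 f12] s1 s2 fd]]].
have [u1 u11 u1E] := rotate_to_complex (ip (T f1) f1).
have [u2 u21 u2E] := rotate_to_complex (ip (T f2) f2).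
have span_unit e : span2 f1 f2 e -> span2 (f1 *> u1) (f2 *> u2) e.
  move=> [a [b ->]]; exists (qconj u1 * a), (qconj u2 * b).
  by rewrite !rscaleA !mulrA !qmul_conjr u11 u21 /qreal !mul1r.
exists (f1 *> u1), (f2 *> u2).
exists (Num.sqrt (qim_norm2 (ip (T f1) f1))), (Num.sqrt (qim_norm2 (ip (T f2) f2))).
split.
- split; last by rewrite !sqrtr_ge0.
  by split; rewrite ?ip_scale ?u11 ?u21 ?f11 ?f22 /qreal ?mulr1// ipZl ipZr f12 mulr0 mul0r.
- exact: span_unit.
- exact: span_unit.
- by rewrite !linearZ !ipZl !ipZr fd !qconjM qconjK mulrA.
- by exists (qre (ip (T f1) f1)), (qre (ip (T f2) f2)); rewrite !quat_form u1E u2E.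
Qed.

End Frames.

(** * Convexity of the upper bild *)

Section UpperBild.
Context {R : realType} {V : quatHilbertType R} (T : {linear V -> V}).
Implicit Types (x y : V) (p q : quat R) (t : R).

(** The numerical range is stable under conjugation by unit quaternions, and a conjugacy class meets
    the closed upper half-plane only in [Re + |Im| i]. *)
Lemma upper_bildP q : upper_bild T q <-> qupper q /\ exists2 x, hnorm x = 1 &
  qre (ip (T x) x) = qre q /\ Num.sqrt (qim_norm2 (ip (T x) x)) = qim_i q.
Proof.
split=> [[[x [_ x1] <-]] qu|[[[qj qk] qi] [x x1 [xre xim]]]].
  split=> //; exists x => //; split => //; case: qu => -[/= uj uk] ui.
  by rewrite /qim_norm2 uj uk expr0n !addr0 sqrtr_sqr ger0_norm.
have [u u1 uE] := rotate_to_complex (ip (T x) x).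
split; last by split.
exists (x *> u); first by split => //=; rewrite hnorm_scale_unit.
rewrite quat_form uE xre xim; apply: quatP; rewrite !quatE//=.
Qed.

Lemma unit_pair_span x y : hnorm x = 1 -> hnorm y = 1 ->
  (exists2 q, qnorm2 q = 1 & y = x *> q) \/
  (exists2 e, orthonormal2 x e & span2 x e y).
Proof.
move=> /hnorm1P x1 /hnorm1P y1; pose z := y - x *> ip y x.
have yE : y = x *> ip y x + z by rewrite addrC subrK.
have zx : ip x z = 0.
  by rewrite /z ipDr ipNr ipZr x1 mulr1 -ipC subrr.
have [z0|z0] := eqVneq z 0.
  left; exists (ip y x); last by rewrite {1}yE z0 addr0.
  have := y1; rewrite {1 2}yE z0 addr0 ip_scale x1 mul1r => /(congr1 qre).
  by rewrite !quatE.
right; have [r r0 r1] := normalize z0.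
exists (z *> qreal r).
  by split => //; [exact/hnorm1P | rewrite ipZr zx mulr0].
exists (ip y x), (qreal r^-1).
by rewrite rscaleA -qrealM mulfV ?gt_eqF// rscale1 -yE.
Qed.

Lemma qre_form_comb f1 f2 (x1 x2 : quat R) :
  ip (T f2) f1 = qconj (ip (T f1) f2) ->
  qre (ip (T (f1 *> x1 + f2 *> x2)) (f1 *> x1 + f2 *> x2)) =
  qre (ip (T f1) f1) * qnorm2 x1 + qre (ip (T f2) f2) * qnorm2 x2
  + 2 * qre (qconj x1 * ip (T f2) f1 * x2).
Proof.
move=> fd; rewrite form_comb.
have -> : ip (T f1) f2 = qconj (ip (T f2) f1) by rewrite fd qconjK.
move: (ip (T f1) f1) (ip (T f2) f2) (ip (T f2) f1) {fd} => h1 h2 g.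
by rewrite /qnorm2 !quatE; ring.
Qed.

(** The off-diagonal terms add up to a quaternion plus its conjugate, hence are real, as are the
    contributions of [h1] and [h2]. *)
Lemma qim_form_comb f1 f2 (x1 x2 : quat R) h1 h2 k1 k2 :
  ip (T f2) f1 = qconj (ip (T f1) f2) ->
  ip (T f1) f1 = (h1, k1, 0, 0) -> ip (T f2) f2 = (h2, k2, 0, 0) ->
  qim_norm2 (ip (T (f1 *> x1 + f2 *> x2)) (f1 *> x1 + f2 *> x2)) =
  qim_norm2 (qconj x1 * (0, k1, 0, 0) * x1 + qconj x2 * (0, k2, 0, 0) * x2).
Proof.
move=> fd f1E f2E; rewrite form_comb.
have -> : ip (T f1) f2 = qconj (ip (T f2) f1) by rewrite fd qconjK.
rewrite f1E f2E {fd}; move: (ip (T f2) f1) => g.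
by congr (_ ^+ 2 + _ ^+ 2 + _ ^+ 2); rewrite !quatE; ring.
Qed.

Lemma upper_bild_avg p q t : 0 <= t <= 1 ->
  upper_bild T p -> upper_bild T q -> upper_bild T (t *: p + (1 - t) *: q).
Proof.
move=> t01 /upper_bildP[[[pj pk] pi] [x x1 [xre xim]]].
move=> /upper_bildP[[[qj qk] qi] [y y1 [yre yim]]].
have /andP[t0 t1] := t01.
apply/upper_bildP; split.
  split; first by (split; rewrite !quatE ?pj ?pk ?qj ?qk !mulr0 addr0).
  by rewrite /= !quatE addr_ge0// mulr_ge0// subr_ge0.
(* If [y] is a unit multiple of [x], then [p] and [q] coincide; otherwise work in a frame of their
   span. *)
have [[u u1 yE]|[e oe ye]] := unit_pair_span x1 y1.
  exists x => //; have [ure uim] := qim_norm2_rotate (ip (T x) x) u1.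
  rewrite !quatE -xre -xim -yre -yim yE quat_form ure uim.
  by split; ring.
have [f1 [f2 [k1 [k2 [[fo [k10 k20]] [a1 [a2 xE]] se fd [h1 [h2 [f1E f2E]]]]]]]] :=
  exists_frame T oe.
have [b1 [b2 yE]] : span2 f1 f2 y by apply: span2_trans ye => //; exists a1, a2.
have [z1 [z2 [z1N z2N zg zim]]] := frame_average (ip (T f2) f1) a1 a2 b1 b2 k10 k20 t01.
have nE (u1 u2 : quat R) : hnorm (f1 *> u1 + f2 *> u2) = 1 <-> qnorm2 u1 + qnorm2 u2 = 1.
  rewrite hnorm1P ip_orthonormal2// !qmul_conjl.
  split => [/(congr1 qre)|h]; first by rewrite !quatE.
  by apply: quatP; rewrite ?quatE ?addr0.
have aN : qnorm2 a1 + qnorm2 a2 = 1 by apply/nE; rewrite -xE.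
have bN : qnorm2 b1 + qnorm2 b2 = 1 by apply/nE; rewrite -yE.
exists (f1 *> z1 + f2 *> z2).
  apply/nE; rewrite z1N z2N addrACA -!mulrDr aN bN; ring.
split.
  rewrite !quatE -xre -yre xE yE !qre_form_comb// zg z1N z2N; ring.
by rewrite (qim_form_comb _ _ fd f1E f2E) zim !quatE -xim -yim xE yE
  !(qim_form_comb _ _ fd f1E f2E).
Qed.

Lemma real_bild_nonempty (e1 e2 : V) : orthonormal2 e1 e2 -> real_bild T !=set0.
Proof.
move=> /(exists_frame T)[f1 [f2 [k1 [k2 [[fo [k10 k20]] _ _ fd
  [h1 [h2 [f1E f2E]]]]]]]].
have [a [b [a0 b0 ab kab]]] : exists a b, [/\ 0 <= a, 0 <= b, a + b = 1 & k1 * a = k2 * b].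
  have [k0|k0] := eqVneq (k1 + k2) 0.
    exists 1, 0; rewrite ler01 lexx addr0; split => //.
    have -> : k1 = 0 by lra.
    by rewrite mul0r mulr0.
  have kk : 0 < k1 + k2 by rewrite lt_neqAle eq_sym k0 addr_ge0.
  exists (k2 / (k1 + k2)), (k1 / (k1 + k2)); split.
  - by rewrite divr_ge0// ltW.
  - by rewrite divr_ge0// ltW.
  - by rewrite -mulrDl addrC divff.
  - by rewrite mulrCA.
(* Since [conj(j) i j = - i], the factor [j] reverses the second imaginary part, and the weights
   [a], [b] make the two cancel. *)
pose z1 := qreal (Num.sqrt a); pose z2 : quat R := (0, 0, Num.sqrt b, 0).
have z1N : qnorm2 z1 = a by rewrite qnorm2_real sqr_sqrtr.
have z2N : qnorm2 z2 = b by rewrite /qnorm2 !quatE sqr_sqrtr// expr0n !addr0 add0r.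
pose x := f1 *> z1 + f2 *> z2.
have x1 : hnorm x = 1.
  apply/hnorm1P; rewrite ip_orthonormal2// !qmul_conjl z1N z2N.
  by apply: quatP; rewrite ?quatE ?addr0.
exists (qre (ip (T x) x)); suff [] : upper_bild T (qreal (qre (ip (T x) x))).
  by move=> h _; split.
apply/upper_bildP; split; first by (split=> //=; rewrite quatE).
exists x => //; split; first by rewrite !quatE.
rewrite (qim_form_comb _ _ fd f1E f2E).
have -> : qim_norm2 (qconj z1 * (0, k1, 0, 0) * z1 + qconj z2 * (0, k2, 0, 0) * z2) =
    (k1 * qnorm2 z1 - k2 * qnorm2 z2) ^+ 2.
  by rewrite /qim_norm2 /qnorm2 /z1 /z2 !quatE; ring.
by rewrite z1N z2N kab subrr expr0n sqrtr0.
Qed.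

End UpperBild.

(** * Cauchy-Schwarz and triangle inequalities *)

Section HilbertNorm.
Context {R : realType} {V : quatHilbertType R}.
Implicit Types (x y z : V) (p q : quat R) (r : R) (T : {linear V -> V}).

Definition qabs q : R := Num.sqrt (qnorm2 q).

Lemma qabs_ge0 q : 0 <= qabs q. Proof. exact: sqrtr_ge0. Qed.

Lemma qabs_eq0 q : qabs q = 0 -> q = 0.
Proof.
move=> /eqP; rewrite sqrtr_eq0 => q0.
by apply: qnorm2_eq0; apply/le_anti; rewrite q0 qnorm2_ge0.
Qed.

Lemma qabsM p q : qabs (p * q) = qabs p * qabs q.
Proof. by rewrite /qabs qnorm2M sqrtrM ?qnorm2_ge0. Qed.

Lemma qabs_sqr q : qabs q ^+ 2 = qnorm2 q.
Proof. by rewrite sqr_sqrtr ?qnorm2_ge0. Qed.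

Lemma qabsD p q : qabs (p + q) <= qabs p + qabs q.
Proof.
rewrite -(@ler_pXn2r _ 2)// ?nnegrE ?addr_ge0 ?qabs_ge0// sqrrD !qabs_sqr.
suff : qre (p * qconj q) <= qabs p * qabs q by rewrite /qnorm2 !quatE; lra.
rewrite -(sqrtrM _ (qnorm2_ge0 p)) -(qnorm2_conj q) -qnorm2M.
apply: le_trans (ler_norm _) _; rewrite -sqrtr_sqr ler_wsqrtr//.
by rewrite /qnorm2 -!addrA lerDl !addr_ge0 ?sqr_ge0.
Qed.

Lemma qre_ip_le x y : qre (ip x y) <= hnorm x * hnorm y.
Proof.
have [->|x0] := eqVneq x 0; first by rewrite ip0l mulr_ge0 ?hnorm_ge0.
have [->|y0] := eqVneq y 0; first by rewrite ip0r mulr_ge0 ?hnorm_ge0.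
have c0 : 0 < 2 * (hnorm x * hnorm y) by rewrite mulr_gt0// mulr_gt0 ?hnorm_gt0.
rewrite -subr_ge0 -(pmulr_rge0 _ c0).
(* This squared norm expands to [2 |x| |y| (|x| |y| - Re <x, y>)]. *)
have := ip_ge0 (x *> qreal (hnorm y) - y *> qreal (hnorm x)).
rewrite !ipDl !ipDr !ipNl !ipNr !ipZl !ipZr (ipC y x) !quatE -!hnorm_sqr.
by move=> h0; apply: (eq_ind _ (>= 0) h0); ring.
Qed.

Lemma qabs_ip_le x y : qabs (ip x y) <= hnorm x * hnorm y.
Proof.
have [->|n0] := eqVneq (qabs (ip x y)) 0; first by rewrite mulr_ge0 ?hnorm_ge0.
have np : 0 < qabs (ip x y) by rewrite lt_neqAle eq_sym n0 qabs_ge0.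
have := qre_ip_le (x *> qconj (ip x y)) y.
rewrite ipZl qmul_conjr hnorm_scale qnorm2_conj -/(qabs _) -qabs_sqr quatE.
by rewrite mulrAC expr2 ler_pM2r.
Qed.

Lemma hnorm_triangle x y : hnorm (x + y) <= hnorm x + hnorm y.
Proof.
rewrite -(@ler_pXn2r _ 2)// ?nnegrE ?addr_ge0 ?hnorm_ge0//.
rewrite sqrrD !hnorm_sqr ipDl !ipDr !quatE (ipC y x) !quatE.
by have := qre_ip_le x y; lra.
Qed.

Lemma hnorm_opp x : hnorm (- x) = hnorm x.
Proof. by rewrite /hnorm ipNl ipNr opprK. Qed.

Lemma hnorm0 : hnorm (0 : V) = 0.
Proof. by rewrite /hnorm ip0l sqrtr0. Qed.

Lemma ip_suml I (s : seq I) (P : pred I) (F : I -> V) y :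
  ip (\sum_(i <- s | P i) F i) y = \sum_(i <- s | P i) ip (F i) y.
Proof. by apply: (big_morph (ip^~ y)) => [? ?|]; rewrite ?ipDl ?ip0l. Qed.

Lemma ip_sumr I (s : seq I) (P : pred I) (F : I -> V) y :
  ip y (\sum_(i <- s | P i) F i) = \sum_(i <- s | P i) ip y (F i).
Proof. by apply: (big_morph (ip y)) => [? ?|]; rewrite ?ipDr ?ip0r. Qed.

Lemma bounded_operator_ge0 T : bounded_operator T ->
  exists2 M, 0 <= M & forall x, hnorm (T x) <= M * hnorm x.
Proof.
move=> [M hM]; exists `|M| => // x; apply: le_trans (hM x) _.
by rewrite ler_wpM2r ?hnorm_ge0 ?ler_norm.
Qed.

End HilbertNorm.

(** * Existence of the adjoint by a Riesz argument *)

Section Adjoint.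
Context {R : realType} {V : quatHilbertType R} (T : {linear V -> V}) (E : nat -> V).
Hypotheses (hT : bounded_operator T) (hE : orthonormal_basis E).
Implicit Types (x y z : V) (p q : quat R) (r : R).

Lemma cauchy_bounded_series (u : nat -> R) B : (forall n, 0 <= u n) ->
  (forall N, \sum_(n < N) u n <= B) ->
  forall eps, 0 < eps -> exists N, forall m n, (N <= n)%N -> (n <= m)%N ->
    \sum_(i < m) u i - \sum_(i < n) u i < eps.
Proof.
move=> u0 uB eps eps0; pose S N := \sum_(n < N) u n.
have Smono m n : (n <= m)%N -> S n <= S m.
  move=> nm; rewrite /S -(subnKC nm) big_split_ord/= lerDl sumr_ge0//.
have Ssup : has_sup (range S).
  by split; [exists (S 0%N); exists 0%N | exists B => _ [N _ <-]; exact: uB].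
have [_ [N _ <-] hN] := sup_adherent eps0 Ssup.
exists N => m n Nn nm; rewrite ltrBlDr.
have Sm : S m <= sup (range S) by apply: sup_ubound; [case: Ssup | exists m].
by have := Smono _ _ Nn; rewrite -/(S m) -/(S n) => ?; lra.
Qed.

Lemma ip_basis_sum (a : nat -> quat R) (N M : nat) : (M <= N)%N ->
  ip (\sum_(n < N) E n *> a n) (\sum_(n < M) E n *> a n) =
  qreal (\sum_(n < M) qnorm2 (a n)).
Proof.
move=> MN; rewrite -(subnKC MN) big_split_ord/= ipDl [X in _ + X]ip_suml.
rewrite [X in _ + X]big1 ?addr0 => [|i _]; last first.
  rewrite ip_sumr big1// => j _; rewrite ipZl ipZr hE.1.
  by rewrite gtn_eqF ?mulr0 ?mul0r// ltn_addr.
rewrite ip_suml (big_morph qreal (id1 := 0) (op1 := +%R)) => [|a0 b0|//]; last first.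
  by apply: quatP; rewrite !quatE ?addr0.
apply: eq_bigr => i _; rewrite ip_sumr (bigD1 i)//= big1 ?addr0 => [|j ji].
  by rewrite ipZl ipZr hE.1 eqxx mulr1 qmul_conjl.
by rewrite ipZl ipZr hE.1 [_ == _](negbTE _) ?mulr0 ?mul0r// eq_sym.
Qed.

(** The vector is the sum of the series with coefficients [conj <T E_n, y>]. Its partial sums
    satisfy [|Z|^2 = <T Z, y> <= M |Z| |y|], so they are bounded, hence Cauchy by orthogonality; the
    identity holds on the basis and extends by density. *)
Lemma adjoint_exists y : exists z, forall x, ip (T x) y = ip x z.
Proof.
have [M M0 TM] := bounded_operator_ge0 hT; have [on dense] := hE.
pose c n := qconj (ip (T (E n)) y); pose Z N := \sum_(n < N) E n *> c n.
pose S N := \sum_(n < N) qnorm2 (c n).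
have ZS N : hnorm (Z N) ^+ 2 = S N by rewrite hnorm_sqr ip_basis_sum.
have TZ N : ip (T (Z N)) y = qreal (S N).
  rewrite linear_sum ip_suml /S (big_morph qreal (id1 := 0) (op1 := +%R)) //; last first.
    by move=> a b; apply: quatP; rewrite !quatE ?addr0.
  by apply: eq_bigr => i _; rewrite linearZ ipZl /c qmul_conjr qnorm2_conj.
have ZB N : hnorm (Z N) <= M * hnorm y.
  have [->|n0] := eqVneq (hnorm (Z N)) 0; first by rewrite mulr_ge0 ?hnorm_ge0.
  have np : 0 < hnorm (Z N) by rewrite lt_neqAle eq_sym n0 hnorm_ge0.
  rewrite -(ler_pM2r np) -expr2 ZS.
  have := qre_ip_le (T (Z N)) y; rewrite TZ quatE => /le_trans; apply.
  by rewrite mulrAC ler_wpM2r ?hnorm_ge0.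
have SB N : S N <= (M * hnorm y) ^+ 2.
  by rewrite -ZS ler_pXn2r ?nnegrE ?mulr_ge0 ?hnorm_ge0.
have ZD m n : (n <= m)%N -> hnorm (Z m - Z n) ^+ 2 = S m - S n.
  move=> nm; rewrite hnorm_sqr ipDl !ipDr !ipNl !ipNr (ipC (Z n) (Z m)) !ip_basis_sum//.
  by rewrite qconj_real !quatE -/(S _) -/(S _); ring.
have [|z zlim] := hnorm_complete Z.
  move=> eps eps0; have e2 : 0 < eps ^+ 2 by rewrite exprn_gt0.
  have [N hN] := cauchy_bounded_series (fun n => qnorm2_ge0 (c n)) SB e2.
  have hN' m n : (N <= n)%N -> (n <= m)%N -> hnorm (Z m - Z n) < eps.
    move=> Nn nm; rewrite -(@ltr_pXn2r _ 2)// ?nnegrE ?hnorm_ge0 ?ltW//.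
    by rewrite ZD// hN.
  exists N => m n Nm Nn; have [nm|/ltnW mn] := leqP n m; first exact: hN'.
  by rewrite -hnorm_opp opprB hN'.
have EZ n N : (n < N)%N -> ip (E n) (Z N) = ip (T (E n)) y.
  move=> nN; rewrite ip_sumr (bigD1 (Ordinal nN))//= big1 ?addr0.
    by rewrite ipZr on eqxx mulr1 qconjK.
  by move=> i /eqP ni; rewrite ipZr on; case: eqP => [ni'|]; [case: ni; apply: val_inj | rewrite mulr0].
have Ez n : ip (E n) z = ip (T (E n)) y.
  apply/eqP; rewrite -subr_eq0; apply/eqP/qabs_eq0/le_anti; rewrite qabs_ge0 andbT.
  apply/ler_addgt0Pl => eps eps0; rewrite addr0.
  (* [L] exceeds [n], so that the partial sum already contains the term of [E n]. *)
  have [N hN] := zlim _ eps0; pose L := maxn N n.+1.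
  rewrite -(EZ n L) ?leq_maxr// -ipNr -ipDr (le_trans (qabs_ip_le _ _))//.
  rewrite /hnorm on eqxx sqrtr1 mul1r -/(hnorm _) -hnorm_opp opprB ltW//.
  by rewrite hN// leq_maxl.
exists z => x; apply/eqP; rewrite -subr_eq0; apply/eqP/qabs_eq0/le_anti.
rewrite qabs_ge0 andbT; apply/ler_addgt0Pl => eps eps0; rewrite addr0.
(* Bounds the functional [<T x, y> - <x, z>], which vanishes on finite combinations; dividing by
   [C + 1] avoids the case [C = 0]. *)
pose C := M * hnorm y + hnorm z.
have C0 : 0 <= C by rewrite addr_ge0 ?mulr_ge0 ?hnorm_ge0.
have C1 : 0 < C + 1 by rewrite ltr_wpDl.
have : closed_span setT E x by rewrite dense.
move=> /(_ _ (divr_gt0 eps0 C1))[N [a [_ xa]]]; set s := \sum_(n < N) _ in xa.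
have sE : ip (T s) y = ip s z.
  rewrite linear_sum !ip_suml; apply: eq_bigr => i _.
  by rewrite linearZ !ipZl Ez.
have -> : ip (T x) y - ip x z = ip (T (x - s)) y - ip (x - s) z.
  by rewrite linearB !ipDl !ipNl sE opprD opprK addrACA addNr addr0.
rewrite -ipNr; apply: le_trans (qabsD _ _) _; apply: le_trans (lerD (qabs_ip_le _ _) (qabs_ip_le _ _)) _.
rewrite hnorm_opp; apply: (@le_trans _ _ (C * hnorm (x - s))).
  by rewrite /C mulrDl (mulrC (hnorm z)) mulrAC lerD2r ler_wpM2r ?hnorm_ge0.
apply: (@le_trans _ _ ((C + 1) * hnorm (x - s))).
  by rewrite ler_wpM2r ?hnorm_ge0// lerDl.
by rewrite -ler_pdivlMl// mulrC ltW.
Qed.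

Lemma adjointP x y : ip (T x) y = ip x (adjoint T y).
Proof.
have [z hz] := adjoint_exists y.
by rewrite /adjoint; case: xgetP => [w _ /(_ x)//|/(_ z)].
Qed.

End Adjoint.

(** * Splitting vectors along the complex subspace *)

Section ComplexOperators.
Context {R : realType} {V : quatHilbertType R} (T : {linear V -> V}) (E : nat -> V).
Hypotheses (hT : bounded_operator T) (hE : complex_basis T E).
Implicit Types (x y u v : V) (p q w : quat R) (r s t : R).

Lemma qcomplexD p q : qcomplex p -> qcomplex q -> qcomplex (p + q).
Proof. by move=> [pj pk] [qj qk]; split; rewrite !quatE ?pj ?pk ?qj ?qk addr0. Qed.

Lemma qcomplexM p q : qcomplex p -> qcomplex q -> qcomplex (p * q).
Proof. by move=> [pj pk] [qj qk]; split; rewrite !quatE ?pj ?pk ?qj ?qk; ring. Qed.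

Lemma qcomplex_conj p : qcomplex p -> qcomplex (qconj p).
Proof. by move=> [pj pk]; split; rewrite !quatE ?pj ?pk oppr0. Qed.

Lemma qcomplexZ r p : qcomplex p -> qcomplex (r *: p).
Proof. by move=> [pj pk]; split; rewrite !quatE ?pj ?pk mulr0. Qed.

Lemma qcomplex_sum I (s : seq I) (P : pred I) (F : I -> quat R) :
  (forall i, qcomplex (F i)) -> qcomplex (\sum_(i <- s | P i) F i).
Proof. by move=> hF; apply: (big_ind qcomplex) => //; exact: qcomplexD. Qed.

Lemma form_qcomplex (L : {linear V -> V}) (a b : nat -> quat R) N :
  (forall n m, qcomplex (ip (L (E n)) (E m))) ->
  (forall n, qcomplex (a n)) -> (forall n, qcomplex (b n)) ->
  qcomplex (ip (L (\sum_(n < N) E n *> a n)) (\sum_(n < N) E n *> b n)).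
Proof.
move=> hL ha hb; rewrite linear_sum ip_suml; apply: qcomplex_sum => i.
rewrite ip_sumr; apply: qcomplex_sum => j; rewrite linearZ ipZl ipZr.
by apply: qcomplexM => //; apply: qcomplexM => //; exact: qcomplex_conj.
Qed.

Lemma complex_subspace_sum (a : nat -> quat R) N : (forall n, qcomplex (a n)) ->
  complex_subspace E (\sum_(n < N) E n *> a n).
Proof. by move=> ha eps eps0; exists N, a; rewrite subrr hnorm0. Qed.

Lemma scale_sum (a : nat -> quat R) N q :
  (\sum_(n < N) E n *> a n) *> q = \sum_(n < N) E n *> (a n * q).
Proof.
rewrite (big_morph (fun x : V => x *> q) (id1 := 0) (op1 := +%R)).
- by apply: eq_bigr => i _; rewrite rscaleA.
- by move=> x y; rewrite rscaleDl.
- exact: (@scaler0 (quatc R) V).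
Qed.

Lemma adjoint_form x : ip (adjoint T x) x = qconj (ip (T x) x).
Proof. by rewrite (adjointP hT hE.1) -ipC. Qed.

Let jj r : quat R := (0, 0, r, 0).

(** The cross terms lie in Cj and have no real part. *)
Lemma ip_complex_pair u v r s : qcomplex (ip v u) ->
  qre (ip (u *> qreal r + v *> jj s) (u *> qreal r + v *> jj s)) =
  r ^+ 2 * qre (ip u u) + s ^+ 2 * qre (ip v v).
Proof.
move=> [vj vk]; rewrite ip_comb (ipC u v) !quatE vj.
have := ip_real v => /(congr1 qim_i); rewrite !quatE => ->.
by have := ip_real v => /(congr1 qim_k); have := ip_real v => /(congr1 qim_j);
  rewrite !quatE => -> ->; ring.
Qed.

(** Conjugation by [j] is complex conjugation on C, which is how the adjoint enters. The cross term
    is a fixed quaternion times [r s]: if it vanishes for [r = s = 1], it vanishes for all [r],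
    [s]. *)
Lemma form_complex_pair u v r s : qcomplex (ip (T v) v) ->
  ip (T (u *> qreal r + v *> jj s)) (u *> qreal r + v *> jj s) =
  r ^+ 2 *: ip (T u) u + s ^+ 2 *: qconj (ip (T v) v) +
  (r * s) *: (ip (T v) u * jj 1 - jj 1 * ip (T u) v).
Proof.
rewrite form_comb; move: (ip (T u) u) (ip (T u) v) (ip (T v) u) (ip (T v) v).
by move=> a b c d [dj dk]; apply: quatP; rewrite !quatE dj dk; ring.
Qed.

Lemma bild_split (a : nat -> quat R) N : let x := \sum_(n < N) E n *> a n in
  hnorm x = 1 -> qcomplex (ip (T x) x) -> let w := ip (T x) x in
  [\/ complex_num_range E T w, complex_num_range E (adjoint T) w |
      exists p q t, [/\ complex_num_range E T p /\ qcomplex p,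
        complex_num_range E (adjoint T) q /\ qcomplex q, 0 <= t <= 1,
        w = t *: p + (1 - t) *: q &
        forall s, 0 <= s <= 1 -> num_range T (s *: p + (1 - s) *: q)]].
Proof.
move=> x x1 xw w.
pose b n : quat R := (qre (a n), qim_i (a n), 0, 0).
pose c n : quat R := (qim_j (a n), qim_k (a n), 0, 0).
have hb n : qcomplex (b n) by split.
have hc n : qcomplex (c n) by split.
pose u := \sum_(n < N) E n *> b n; pose v := \sum_(n < N) E n *> c n.
(* The inner product is treated as the form of the identity. *)
have hid n m : qcomplex (ip (idfun (E n)) (E m)).
  by rewrite /= hE.1.1; case: eqP.
have vu : qcomplex (ip v u) by exact: (form_qcomplex (L := idfun)).
have uu : qcomplex (ip (T u) u) by apply: form_qcomplex => //; exact: hE.2.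
have vv : qcomplex (ip (T v) v) by apply: form_qcomplex => //; exact: hE.2.
have Tvu : qcomplex (ip (T v) u) by apply: form_qcomplex => //; exact: hE.2.
have Tuv : qcomplex (ip (T u) v) by apply: form_qcomplex => //; exact: hE.2.
have xE : x = u *> qreal 1 + v *> jj 1.
  rewrite !scale_sum -big_split/=; apply: eq_bigr => i _.
  by rewrite -rscaleDr; congr (_ *: _); apply: quatP; rewrite !quatE; ring.
pose X := ip (T v) u * jj 1 - jj 1 * ip (T u) v.
have wE : w = ip (T u) u + qconj (ip (T v) v) + X.
  by rewrite /w xE form_complex_pair// !expr1n mulr1 !scale1r.
(* [X] lies in Cj by its formula, and in C as a difference of complex numbers. *)
have X0 : X = 0.
  have [_ Xj Xk] : [/\ True, qim_j X = 0 & qim_k X = 0].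
    have -> : X = w - (ip (T u) u + qconj (ip (T v) v)) by rewrite wE addrC addKr.
    by case: xw => wj wk; case: uu => uj uk; case: vv => vj vk; split => //;
      rewrite !quatE ?uj ?uk ?vj ?vk -/w ?wj ?wk; ring.
  case: Tvu => vj vk; case: Tuv => uj uk.
  apply: quatP => //; rewrite !quatE ?uj ?uk ?vj ?vk; ring.
have nuv : hnorm u ^+ 2 + hnorm v ^+ 2 = 1.
  have := hnorm_sqr x; rewrite x1 xE ip_complex_pair// !hnorm_sqr expr1n !mul1r.
  by move->.
have cu r : complex_subspace E (u *> qreal r).
  rewrite scale_sum; apply: (@complex_subspace_sum (fun n => b n * qreal r)) => n.
  exact: qcomplexM.
have cv r : complex_subspace E (v *> qreal r).
  rewrite scale_sum; apply: (@complex_subspace_sum (fun n => c n * qreal r)) => n.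
  exact: qcomplexM.
have [u0|u0] := eqVneq u 0.
  apply: Or32; exists (v *> qreal 1).
    split => //=; rewrite /= /qreal rscale1.
    move: nuv; rewrite u0 hnorm0 expr0n add0r => /eqP.
    by rewrite sqrp_eq1 ?hnorm_ge0// => /eqP.
  by rewrite rscale1 adjoint_form wE u0 X0 ip0r add0r addr0.
have [v0|v0] := eqVneq v 0.
  apply: Or31; exists (u *> qreal 1).
    split => //=; rewrite /= /qreal rscale1.
    move: nuv; rewrite v0 hnorm0 expr0n addr0 => /eqP.
    by rewrite sqrp_eq1 ?hnorm_ge0// => /eqP.
  by rewrite rscale1 wE v0 X0 ip0r qconj0 !addr0.
have nu := hnorm_gt0 u0; have nv := hnorm_gt0 v0.
pose r := (hnorm u)^-1; pose s := (hnorm v)^-1.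
have ru : hnorm (u *> qreal r) = 1.
  by rewrite hnorm_scale qnorm2_real sqrtr_sqr gtr0_norm ?invr_gt0// mulfV ?gt_eqF.
have sv : hnorm (v *> qreal s) = 1.
  by rewrite hnorm_scale qnorm2_real sqrtr_sqr gtr0_norm ?invr_gt0// mulfV ?gt_eqF.
have pE : ip (T (u *> qreal r)) (u *> qreal r) = r ^+ 2 *: ip (T u) u.
  by rewrite linearZ ip_scale_real -qreal_scale.
have qE : ip (adjoint T (v *> qreal s)) (v *> qreal s) = s ^+ 2 *: qconj (ip (T v) v).
  rewrite adjoint_form linearZ ip_scale_real -qreal_scale.
  by apply: quatP; rewrite !quatE; ring.
have rn : r ^+ 2 * hnorm u ^+ 2 = 1 by rewrite -exprMn mulVf ?gt_eqF// expr1n.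
have sn : s ^+ 2 * hnorm v ^+ 2 = 1 by rewrite -exprMn mulVf ?gt_eqF// expr1n.
(* The ends are the values at the normalised [u] and [v]; the weight of the first is [|u|^2]. *)
apply: Or33; exists (r ^+ 2 *: ip (T u) u), (s ^+ 2 *: qconj (ip (T v) v)), (hnorm u ^+ 2).
split.
- by split; [exists (u *> qreal r) | exact: qcomplexZ].
- by split; [exists (v *> qreal s) | apply: qcomplexZ; exact: qcomplex_conj].
- by rewrite sqr_ge0 -nuv lerDl sqr_ge0.
- have -> : 1 - hnorm u ^+ 2 = hnorm v ^+ 2 by rewrite -nuv addrC addKr.
  by rewrite !scalerA mulrC rn mulrC sn !scale1r wE X0 addr0.
move=> t /andP[t0 t1]; have t1' : 0 <= 1 - t by rewrite subr_ge0.
(* Rescaling gives the two components squared norms [t] and [1 - t], while the cross term stays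
   zero. *)
pose al := r * Num.sqrt t; pose be := s * Num.sqrt (1 - t).
have alE : al ^+ 2 = t * r ^+ 2 by rewrite exprMn sqr_sqrtr// mulrC.
have beE : be ^+ 2 = (1 - t) * s ^+ 2 by rewrite exprMn sqr_sqrtr// mulrC.
exists (u *> qreal al + v *> jj be).
  split => //=; rewrite /hnorm ip_complex_pair// alE beE -!hnorm_sqr -(mulrA t) -(mulrA (1 - t)).
  by rewrite rn sn !mulr1 addrC subrK sqrtr1.
by rewrite form_complex_pair// -/X X0 scaler0 addr0 alE beE !scalerA.
Qed.

End ComplexOperators.

(** * Closures, convex hulls and compact sets of quaternions *)

Section QuaternionTopology.
Context {R : realType}.
Implicit Types (p q : quat R) (r t : R) (A K : set (quat R)).

Definition qsegments K : set (quat R) :=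
  [set w | exists t p q, [/\ 0 <= t <= 1, K p, K q & w = t *: p + (1 - t) *: q]].

Lemma closure_quatP A q :
  closure A q <-> forall eps : R, 0 < eps -> exists2 p, A p & qabs (p - q) < eps.
Proof.
split=> [clA eps eps0|clA B].
  have [|p [Ap pq]] := clA [set p | qabs (p - q) < eps]; last by exists p.
  (* Four coordinates, each within [eps / 2], give Euclidean distance less than [eps]. *)
  have e2 : 0 < eps / 2 by rewrite divr_gt0.
  apply/(@nbhs_ballP R (R * R * R * R)%type); exists (eps / 2) => //= p.
  move=> [[[/= b0 b1] b2] b3]; have sq (x y : R) : ball x (eps / 2) y ->
      (y - x) ^+ 2 < (eps / 2) ^+ 2.
    rewrite /ball/= distrC -(@ltr_pXn2r _ 2)// ?nnegrE ?(ltW e2)//.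
    by rewrite real_normK ?num_real.
  rewrite /= -(@ltr_pXn2r _ 2)// ?nnegrE ?qabs_ge0 ?(ltW eps0)// qabs_sqr.
  move: (sq _ _ b0) (sq _ _ b1) (sq _ _ b2) (sq _ _ b3) => {b0 b1 b2 b3}.
  rewrite /qnorm2 !quatE /qre /qim_i /qim_j /qim_k.
  have -> : (eps / 2) ^+ 2 = eps ^+ 2 / 4 by field.
  by rewrite /= => ? ? ? ?; lra.
move=> /(@nbhs_ballP R (R * R * R * R)%type)[eps /= eps0 qB].
have [p Ap pq] := clA _ eps0; exists p; split => //; apply: qB.
have : qnorm2 (p - q) < eps ^+ 2.
  by rewrite -qabs_sqr ltr_pXn2r// nnegrE ?qabs_ge0// ltW.
rewrite /qnorm2 !quatE => pq2.
have h0 := sqr_ge0 (qre p - qre q); have h1 := sqr_ge0 (qim_i p - qim_i q).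
have h2 := sqr_ge0 (qim_j p - qim_j q); have h3 := sqr_ge0 (qim_k p - qim_k q).
have small (x : R) : x ^+ 2 < eps ^+ 2 -> `|- x| < eps.
  move=> xe; rewrite normrN -(@ltr_pXn2r _ 2)// ?nnegrE// ?real_normK ?num_real//.
  exact: ltW.
by split; [split; [split|]|]; rewrite /ball/= -opprB; apply: small; lra.
Qed.

Lemma closure_avg A : (forall t p q, 0 <= t <= 1 -> A p -> A q -> A (t *: p + (1 - t) *: q)) ->
  forall t p q, 0 <= t <= 1 -> closure A p -> closure A q ->
    closure A (t *: p + (1 - t) *: q).
Proof.
move=> hA t p q t01 /closure_quatP clp /closure_quatP clq; apply/closure_quatP => eps eps0.
have e2 : 0 < eps / 2 by rewrite divr_gt0.
have [p' Ap' pp'] := clp _ e2; have [q' Aq' qq'] := clq _ e2.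
exists (t *: p' + (1 - t) *: q'); first exact: hA.
have -> : t *: p' + (1 - t) *: q' - (t *: p + (1 - t) *: q) =
    qreal t * (p' - p) + qreal (1 - t) * (q' - q).
  by apply: quatP; rewrite !quatE; ring.
have /andP[t0 t1] := t01; have s0 : 0 <= 1 - t by rewrite subr_ge0.
apply: le_lt_trans (qabsD _ _) _; rewrite !qabsM /qabs !qnorm2_real !sqrtr_sqr !ger0_norm//.
rewrite -!/(qabs _) (@le_lt_trans _ _ (eps / 2))//; last by rewrite ltr_pdivrMr// ltr_pMr// ltr1n.
have := ler_wpM2l t0 (ltW pp'); have := ler_wpM2l s0 (ltW qq'); lra.
Qed.

Lemma conv_avg A t p q : 0 <= t <= 1 ->
  conv_hull A p -> conv_hull A q -> conv_hull A (t *: p + (1 - t) *: q).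
Proof.
move=> /andP[t0 t1] hp hq M [cM AM].
have := cM p q (Itv01 t0 t1); rewrite !inE; apply; [exact: hp|exact: hq].
Qed.

Lemma conv_hull_sub A K : (forall t p q, 0 <= t <= 1 -> K p -> K q -> K (t *: p + (1 - t) *: q)) ->
  A `<=` K -> conv_hull A `<=` K.
Proof.
move=> hK AK; apply: smallest_sub => // p q l; rewrite !inE => Kp Kq.
by apply: hK => //; apply/andP; split.
Qed.

Lemma quat_hausdorff : hausdorff_space (quat R).
Proof. exact: (@norm_hausdorff R (R * R * R * R)%type). Qed.

Lemma closed_bounded_compact A (M : R) : closed A ->
  (forall q, A q -> qabs q <= M) -> compact A.
Proof.
move=> clA bA; pose I := `[- M, M]%classic : set R.
have cI : compact I by exact: segment_compact.
have cbox : compact (I `*` I `*` I `*` I) by do !apply: compact_setX.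
apply: (@subclosed_compact (quat R) _ _ clA cbox) => q Aq.
have := bA q Aq; move=> qM.
have M0 : 0 <= M by apply: le_trans qM; exact: qabs_ge0.
have : qnorm2 q <= M ^+ 2 by rewrite -qabs_sqr ler_pXn2r ?nnegrE ?qabs_ge0.
rewrite /qnorm2 => q2.
have h0 := sqr_ge0 (qre q); have h1 := sqr_ge0 (qim_i q).
have h2 := sqr_ge0 (qim_j q); have h3 := sqr_ge0 (qim_k q).
have small (x : R) : x ^+ 2 <= M ^+ 2 -> I x.
  move=> xM; rewrite /I /= in_itv/= -ler_norml -(@ler_pXn2r _ 2)// ?nnegrE//.
  by rewrite real_normK ?num_real.
by split; [split; [split|]|]; apply: small; lra.
Qed.

(** A continuous image of [[0, 1] x K x K]. *)
Lemma compact_qsegments K : compact K -> compact (qsegments K).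
Proof.
move=> cK; pose f (z : R * quat R * quat R) : quat R := z.1.1 *: z.1.2 + (1 - z.1.1) *: z.2.
have -> : qsegments K = f @` (`[0, 1]%classic `*` K `*` K).
  apply/seteqP; split => [w [t [p [q [t01 Kp Kq ->]]]]|_ [[[t p] q] [[/= t01 Kp] Kq] <-]].
    by exists (t, p, q).
  by exists t, p, q; split => //; move: t01; rewrite in_itv.
apply: continuous_compact; last first.
  by do !apply: compact_setX => //; exact: segment_compact.
apply: continuous_subspaceT => -[[t p] q].
have c1 : (z : R * quat R * quat R).1 @[z --> (t, p, q)] --> (t, p).
  exact: (@cvg_fst _ _ (nbhs (t, p)) (nbhs q)).
have c11 : (z : R * quat R * quat R).1.1 @[z --> (t, p, q)] --> t.
  by apply: (cvg_comp _ _ c1); exact: (@cvg_fst _ _ (nbhs t) (nbhs p)).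
have c12 : (z : R * quat R * quat R).1.2 @[z --> (t, p, q)] --> p.
  by apply: (cvg_comp _ _ c1); exact: (@cvg_snd _ _ (nbhs t) (nbhs p)).
have c2 : (z : R * quat R * quat R).2 @[z --> (t, p, q)] --> q.
  exact: (@cvg_snd _ _ (nbhs (t, p)) (nbhs q)).
pose W := (R * R * R * R)%type.
apply: (@cvgD R W); first exact: (@cvgZ R W).
by apply: (@cvgZ R W) => //; apply: cvgB => //; exact: cvg_cst.
Qed.

End QuaternionTopology.

(** * The closure of the upper bild as a convex hull *)

Section Closure.
Context {R : realType} {V : quatHilbertType R} (T : {linear V -> V}) (E : nat -> V).
Hypotheses (hT : bounded_operator T) (hE : complex_basis T E).
Implicit Types (x y u v : V) (p q w : quat R) (r s t : R).

Lemma crossing p q t : 0 <= t <= 1 -> 0 <= qim_i p -> qim_i q < 0 ->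
  0 <= qim_i (t *: p + (1 - t) *: q) ->
  exists s a, [/\ 0 <= s <= 1, 0 <= a <= 1, qim_i (s *: p + (1 - s) *: q) = 0 &
    t *: p + (1 - t) *: q = a *: p + (1 - a) *: (s *: p + (1 - s) *: q)].
Proof.
rewrite !quatE; set P := qim_i p; set Q := qim_i q => /andP[t0 t1] P0 Q0 tpq.
have PQ : 0 < P - Q by lra.
(* The parameter at which the segment crosses the real line. *)
pose s := - Q / (P - Q).
have s0 : 0 <= s by rewrite divr_ge0 ?oppr_ge0 ?ltW.
have s1' : 1 - s = P / (P - Q) by rewrite /s; field; rewrite gt_eqF.
have s1 : 0 <= 1 - s by rewrite s1' divr_ge0// ltW.
have sQ : s * P + (1 - s) * Q = 0 by rewrite s1' /s; field; rewrite gt_eqF.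
have st : s <= t by rewrite ler_pdivrMr//; lra.
(* Matching the weights of [q] determines [a], unless the crossing is at [p]; then [t = 1] and any
   [a] works. *)
have [a [a01 aE]] : exists a, 0 <= a <= 1 /\ (1 - t) = (1 - a) * (1 - s).
  have [es|ns] := eqVneq (1 - s) 0.
    by exists 0; rewrite lexx ler01 es mulr0; split => //; lra.
  have sp : 0 < 1 - s by rewrite lt_neqAle eq_sym ns.
  exists (1 - (1 - t) / (1 - s)); split; last by rewrite subKr divfK.
  have d0 : 0 <= (1 - t) / (1 - s) by rewrite divr_ge0// subr_ge0.
  have d1 : (1 - t) / (1 - s) <= 1 by rewrite ler_pdivrMr// mul1r lerD2l lerN2.
  by apply/andP; split; lra.
exists s, a; split => //; first by apply/andP; split; lra.
rewrite scalerDr !scalerA addrA -scalerDl -aE.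
suff -> : a + (1 - a) * s = t by [].
by apply: (@addIr _ (1 - t)); rewrite [in LHS]aE; ring.
Qed.

Lemma real_bild_bound : exists M, forall r, real_bild T r -> `|r| <= M.
Proof.
have [M M0 TM] := bounded_operator_ge0 hT; exists M => r [[x [_ x1] xr] _].
have -> : `|r| = qabs (qreal r) by rewrite /qabs qnorm2_real sqrtr_sqr.
rewrite -xr (le_trans (qabs_ip_le _ _))// x1 mulr1.
by have := TM x; rewrite x1 mulr1.
Qed.

Lemma real_bild_segment r : real_bild T r ->
  inf (real_bild T) <= r <= sup (real_bild T).
Proof.
move=> br; have [M bM] := real_bild_bound; apply/andP; split.
  by apply: inf_lbound => //; exists (- M) => s /bM; rewrite ler_norml => /andP[].
by apply: sup_ubound => //; exists M => s /bM; rewrite ler_norml => /andP[].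
Qed.

Lemma real_bild_has_sup : has_sup (real_bild T) /\ has_inf (real_bild T).
Proof.
have ne : real_bild T !=set0.
  by apply: (@real_bild_nonempty _ _ T (E 0) (E 1)); split; rewrite hE.1.1.
have [M bM] := real_bild_bound.
by split; split => //; [exists M | exists (- M)] => s /bM; rewrite ler_norml => /andP[].
Qed.

Lemma endpoints_closure :
  closure (upper_bild T) (qreal (inf (real_bild T))) /\
  closure (upper_bild T) (qreal (sup (real_bild T))).
Proof.
have [hs hi] := real_bild_has_sup.
have up r : real_bild T r -> upper_bild T (qreal r).
  by move=> [nr _]; split => //; split => //=; rewrite quatE.
have dist r s : qabs (qreal r - qreal s) = `|r - s|.
  have -> : qreal r - qreal s = qreal (r - s).
    by apply: quatP; rewrite !quatE ?subrr.
  by rewrite /qabs qnorm2_real sqrtr_sqr.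
split; apply/closure_quatP => eps eps0.
  have [r br rs] := inf_adherent eps0 hi; exists (qreal r); first exact: up.
  have /andP[h1 h2] := real_bild_segment br.
  by rewrite dist ger0_norm ?subr_ge0//; lra.
have [r br rs] := sup_adherent eps0 hs; exists (qreal r); first exact: up.
have /andP[h1 h2] := real_bild_segment br.
by rewrite dist distrC ger0_norm ?subr_ge0//; lra.
Qed.

(** The generators of the hull, with the two endpoints replaced by the whole real segment between
    them, so that every crossing point belongs to [K]. *)
Let K : set (quat R) := closure (upper_complex_num_range E T)
  `|` closure (upper_complex_num_range E (adjoint T))
  `|` [set qreal r | r in `[inf (real_bild T), sup (real_bild T)]%classic].

Lemma generators_compact : compact K.
Proof.
have [M M0 TM] := bounded_operator_ge0 hT.
have clb A : (forall q, A q -> qabs q <= M) -> compact (closure A : set (quat R)).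
  move=> bA; apply: (@closed_bounded_compact _ _ (M + 1)); first exact: closed_closure.
  move=> q /closure_quatP/(_ 1 ltr01)[p /bA pM pq].
  have -> : q = p + - (p - q) by rewrite opprB addrCA subrr addr0.
  rewrite (le_trans (qabsD _ _))// lerD//.
  by rewrite (_ : qabs (- _) = qabs (p - q)) ?ltW// /qabs /qnorm2 !quatE; congr Num.sqrt; ring.
have wM x : hnorm x = 1 -> qabs (ip (T x) x) <= M.
  by move=> x1; rewrite (le_trans (qabs_ip_le _ _))// x1 mulr1; have := TM x; rewrite x1 mulr1.
apply: compactU; first apply: compactU.
- by apply: clb => q [[x [_ x1] <-] _]; exact: wM.
- apply: clb => q [[x [_ x1] <-] _].
  by rewrite (adjoint_form hT hE) /qabs qnorm2_conj; exact: wM.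
apply: continuous_compact; last exact: segment_compact.
apply: continuous_subspaceT => r.
have -> : @qreal R = fun s => s *: (1 : quat R).
  by apply/funext => s; apply: quatP; rewrite !quatE ?mulr1 ?mulr0.
by apply: (@cvgZ R (R * R * R * R)%type); [exact: cvg_id | exact: cvg_cst].
Qed.

Lemma finite_sum_dense x : hnorm x = 1 -> forall eps, 0 < eps ->
  exists N (a : nat -> quat R), let s := \sum_(n < N) E n *> a n in
    hnorm s = 1 /\ hnorm (x - s) < eps.
Proof.
(* The bound [1 / 2] keeps the approximant nonzero; normalising it at most doubles the error, hence
   [eps / 2]. *)
move=> x1 eps eps0; pose d := Num.min (eps / 2) (1 / 2) : R.
have d0 : 0 < d by rewrite lt_min !divr_gt0.
have : closed_span setT E x by rewrite hE.1.2.
move=> /(_ d d0)[N [a [_]]]; set s := \sum_(n < N) _ => xs.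
have xs2 : hnorm (x - s) < 1 / 2 /\ hnorm (x - s) < eps / 2.
  by move: xs; rewrite lt_min => /andP[].
have tri1 : 1 <= hnorm (x - s) + hnorm s by have := hnorm_triangle (x - s) s; rewrite subrK x1.
have tri2 : hnorm s <= hnorm (x - s) + 1.
  by have := hnorm_triangle (s - x) x; rewrite subrK -(hnorm_opp (s - x)) opprB x1.
have ns0 : 0 < hnorm s by lra.
pose r := (hnorm s)^-1; exists N, (fun n => a n * qreal r).
rewrite -scale_sum -/s /=.
have rs1 : hnorm (s *> qreal r) = 1.
  by rewrite hnorm_scale qnorm2_real sqrtr_sqr gtr0_norm ?invr_gt0// mulfV ?gt_eqF.
split => //; have -> : x - s *> qreal r = (x - s) + s *> qreal r *> qreal (hnorm s - 1).
  rewrite rscaleA -qrealM /r mulrBr mulr1 mulVf ?gt_eqF//.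
  have -> : qreal (1 - (hnorm s)^-1) = 1 - qreal r :> quat R.
    by apply: quatP; rewrite !quatE ?subrr ?subr0.
  rewrite rscaleDr rscale1 addrA subrK; congr (_ + _).
  by apply/eqP; rewrite eq_sym -addr_eq0 -rscaleDr addNr rscale0.
apply: le_lt_trans (hnorm_triangle _ _) _.
rewrite hnorm_scale rs1 mul1r qnorm2_real sqrtr_sqr.
have : `|hnorm s - 1| <= hnorm (x - s) by rewrite ler_norml; apply/andP; split; lra.
lra.
Qed.

(** The dense part: for a finite combination, splitting the coefficients gives components in the
    complex subspace without any limit. *)
Definition finite_upper_bild : set (quat R) := [set w | qupper w /\
  exists N (a : nat -> quat R), let x := \sum_(n < N) E n *> a n in
    hnorm x = 1 /\ w = ip (T x) x].

Lemma upper_bild_sub_closure : upper_bild T `<=` closure finite_upper_bild.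
Proof.
have [M M0 TM] := bounded_operator_ge0 hT.
move=> w [[x [_ x1] <-] [[wj wk] /= wi]]; apply/closure_quatP => eps eps0.
have M1 : 0 < M + 1 by rewrite ltr_wpDl.
have d0 : 0 < eps / (2 * (M + 1)) by rewrite divr_gt0// mulr_gt0.
have [N [a [s1 xs]]] := finite_sum_dense x1 d0.
move: s1 xs; set s := \sum_(n < N) _ => s1 xs.
have ws : qabs (ip (T s) s - ip (T x) x) < eps.
  have -> : ip (T s) s - ip (T x) x = - (ip (T (x - s)) x + ip (T s) (x - s)).
    by rewrite linearB ipDl ipDr !ipNl !ipNr addrA subrK opprB.
  have -> q : qabs (- q) = qabs q by rewrite /qabs /qnorm2 !quatE !sqrrN.
  apply: le_lt_trans (qabsD _ _) _.
  have h1 := qabs_ip_le (T (x - s)) x; have h2 := qabs_ip_le (T s) (x - s).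
  have h3 := TM (x - s); have h4 := TM s.
  have h5 := ler_wpM2r (hnorm_ge0 (x - s)) h4.
  rewrite x1 mulr1 in h1; rewrite s1 mulr1 in h5.
  have h6 : hnorm (x - s) * (2 * (M + 1)) < eps by rewrite -ltr_pdivlMr ?mulr_gt0.
  have h7 := hnorm_ge0 (x - s).
  by apply: le_lt_trans (lerD h1 h2) _; nra.
have [u u1 uE] := rotate_to_complex (ip (T s) s).
exists (ip (T (s *> u)) (s *> u)).
  split; first by rewrite quat_form uE; split; [split|]; rewrite /= ?quatE ?sqrtr_ge0.
  exists N, (fun n => a n * u); rewrite -scale_sum -/s /=.
  by rewrite hnorm_scale_unit.
(* Rotating [<T s, s>] into the upper half-plane brings it no farther from [<T x, x>]: the gain is
   [2 qim_i <T x, x> (k - qim_i W)], which is nonnegative. *)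
rewrite quat_form uE; apply: le_lt_trans ws; rewrite /qabs ler_wsqrtr//.
set W := ip (T s) s; set k := Num.sqrt _; rewrite /qnorm2 !quatE wj wk.
have kk : k ^+ 2 = qim_norm2 W by rewrite sqr_sqrtr ?qim_norm2_ge0.
have kb : qim_i W <= k.
  rewrite (le_trans (ler_norm _))// -sqrtr_sqr ler_wsqrtr// /qim_norm2 -addrA lerDl.
  by rewrite addr_ge0 ?sqr_ge0.
have := mulr_ge0 wi (etrans (subr_ge0 _ _) kb : 0 <= k - qim_i W).
by move: kk; rewrite /qim_norm2; lra.
Qed.

(** An end of the segment below the real line is replaced by the crossing point, which lies in the
    real bild; the two ends cannot both be below. *)
Lemma finite_upper_bild_sub : finite_upper_bild `<=` qsegments K.
Proof.
have KU p : upper_complex_num_range E T p -> K p.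
  by move=> h; left; left; exact: subset_closure.
have KA p : upper_complex_num_range E (adjoint T) p -> K p.
  by move=> h; left; right; exact: subset_closure.
have KR w : bild T w -> qim_i w = 0 -> K w.
  move=> bw wi; right; have wE : qreal (qre w) = w.
    by case: (bw) => _ [wj wk]; apply: quatP; rewrite !quatE.
  exists (qre w) => //; rewrite /= in_itv/=; apply: real_bild_segment.
  by rewrite /real_bild /= wE.
have K1 w : K w -> qsegments K w.
  move=> Kw; exists 1, w, w; rewrite lexx ler01; split => //.
  by rewrite subrr scale1r scale0r addr0.
move=> w [wu [N [a [x1 wE]]]]; have wc : qcomplex w by case: wu.
have := bild_split hT hE x1; rewrite -wE.
case => // [wT|wA|[p [q [t [[pT pc] [qA qc] t01 wpq seg]]]]].
- by apply/K1/KU.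
- by apply/K1/KA.
have segK s : 0 <= s <= 1 -> qim_i (s *: p + (1 - s) *: q) = 0 -> K (s *: p + (1 - s) *: q).
  move=> s01 si; apply: KR => //; split; first exact: seg.
  by apply: qcomplexD; exact: qcomplexZ.
have wi : 0 <= qim_i w by case: wu.
rewrite wpq in wi *; have [p0|p0] := leP 0 (qim_i p); have [q0|q0] := leP 0 (qim_i q).
- by exists t, p, q; split => //; [exact: KU | exact: KA].
- have [s [b [s01 b01 si ->]]] := crossing t01 p0 q0 wi.
  by exists b, p, (s *: p + (1 - s) *: q); split => //; [exact: KU | exact: segK].
- have flip s : s *: p + (1 - s) *: q = (1 - s) *: q + (1 - (1 - s)) *: p.
    by rewrite subKr addrC.
  have flip01 s : 0 <= s <= 1 -> 0 <= 1 - s <= 1.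
    by move=> /andP[? ?]; apply/andP; split; lra.
  rewrite flip in wi *.
  have [s [b [s01 b01 si ->]]] := crossing (flip01 _ t01) q0 p0 wi.
  exists b, q, (s *: q + (1 - s) *: p); split => //; first exact: KA.
  have -> : s *: q + (1 - s) *: p = (1 - s) *: p + (1 - (1 - s)) *: q by rewrite flip !subKr.
  by apply: segK; [exact: flip01 | rewrite addrC subKr].
- move: wi t01; rewrite !quatE => wi /andP[t0 t1].
  by exfalso; nra.
Qed.

Lemma closure_upper_bild_hull : closure (upper_bild T) =
  conv_hull (closure (upper_complex_num_range E T)
             `|` closure (upper_complex_num_range E (adjoint T))
             `|` [set qreal (inf (real_bild T)); qreal (sup (real_bild T))]).
Proof.
set G := _ `|` _ `|` _; apply/seteqP; split.
  have clS : closed (qsegments K).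
    by apply: compact_closed; [exact: quat_hausdorff | exact/compact_qsegments/generators_compact].
  have clE : qsegments K = closure (qsegments K) by exact/closure_id.
  have sub : upper_bild T `<=` qsegments K.
    apply: subset_trans upper_bild_sub_closure _.
    by rewrite [X in _ `<=` X]clE; apply: closureS; exact: finite_upper_bild_sub.
  have GH : G `<=` conv_hull G by exact: sub_gen_smallest.
  (* A real point of [K] is a combination of the endpoints; equal endpoints are treated apart, as
     the weights divide by their distance. *)
  have KH : K `<=` conv_hull G.
    move=> q [[qT|qA]|[r]]; [by apply: GH; left; left | by apply: GH; left; right|].
    rewrite /= in_itv/=; set i := inf _; set m := sup _ => /andP[ir rm] <-.
    have Hi : conv_hull G (qreal i) by apply: GH; right; left.
    have Hm : conv_hull G (qreal m) by apply: GH; right; right.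
    have [im|im] := eqVneq m i.
      by rewrite (_ : r = i)//; apply/le_anti; rewrite ir -im rm.
    have d0 : 0 < m - i by rewrite subr_gt0 lt_neqAle eq_sym im (le_trans ir rm).
    have -> : qreal r = ((m - r) / (m - i)) *: qreal i + (1 - (m - r) / (m - i)) *: qreal m.
      by apply: quatP; rewrite !quatE ?mulr0 ?addr0//; field; rewrite gt_eqF.
    apply: conv_avg => //; rewrite divr_ge0 ?subr_ge0//=; last exact: le_trans rm.
    by rewrite ler_pdivrMr// mul1r lerD2l lerN2.
  move=> w /(closureS sub); rewrite -clE => -[t [p [q [t01 Kp Kq ->]]]].
  by apply: conv_avg => //; exact: KH.
apply: conv_hull_sub.
  by apply: closure_avg => t p q; exact: upper_bild_avg.
have [ci cs] := endpoints_closure.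
move=> q [[|]|[->|->]]//; apply: closureS => w [[x [_ x1] <-] wu].
  by split => //; exists x.
split => //; have [[wj wk] _] := wu; rewrite (adjoint_form hT hE) in wj wk *.
(* Multiplying [x] by [j] conjugates the complex number [<T x, x>], which yields the value of the
   adjoint at [x]. *)
exists (x *> ((0, 0, 1, 0) : quat R)).
  by split => //=; rewrite hnorm_scale_unit// /qnorm2 !quatE; ring.
rewrite quat_form; move: wj wk; rewrite !quatE => /eqP; rewrite oppr_eq0 => /eqP wj.
move=> /eqP; rewrite oppr_eq0 => /eqP wk.
by apply: quatP; rewrite !quatE ?wj ?wk; ring.
Qed.

End Closure.

Theorem theorem3p3 (R : realType) (V : quatHilbertType R)
    (T : {linear V -> V}) (E : nat -> V)
    (hT : bounded_operator T) (hE : complex_basis T E) :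
  closure (upper_bild T) =
  conv_hull (closure (upper_complex_num_range E T)
             `|` closure (upper_complex_num_range E (adjoint T))
             `|` [set qreal (inf (real_bild T)); qreal (sup (real_bild T))]).
Proof. exact: closure_upper_bild_hull. Qed.
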